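(* Let $\mu,\nu$ be probability measures on $\{0,1\}^{\mathbb N}$. (a) If $\mu$ and $\nu$ are $K$-trivial, then $\mu\times\nu$ is $K$-trivial. (b) If $\mu$ and $\nu$ are $C$-trivial, then $\mu\times\nu$ is $C$-trivial.
   Context: $K$, $C$ denote prefix-free and plain Kolmogorov complexity; $n$ is identified with $0^n$, and the universal machines satisfy $C(n)\le C(x)$, $K(n)\le K(x)$ whenever $|x|=n$. For a measure $\mu$, $K(\mu\upharpoonright n)=\sum_{|x|=n}K(x)\mu[x]$, $C(\mu\upharpoonright n)=\sum_{|x|=n}C(x)\mu[x]$. $\mu$ is $K$-trivial if $\exists c\,\forall n\,K(\mu\upharpoonright n)\le K(n)+c$, and $C$-trivial if $\exists c\,\forall n\,C(\mu\upharpoonright n)\le C(n)+c$. The product $\mu\times\nu$ is viewed as a measure on $\{0,1\}^{\mathbb N}$ via the homeomorphism $(A,B)\mapsto A\oplus B$ (where $(A\oplus B)(2k)=A(k)$, $(A\oplus B)(2k+1)=B(k)$). *)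

(* Defs.v *)
From HB Require Import structures.
From mathcomp Require Import all_boot all_order all_algebra.
From mathcomp Require Import all_classical all_reals all_analysis.

Set Implicit Arguments.
Unset Strict Implicit.
Unset Printing Implicit Defensive.

Import Order.TTheory GRing.Theory Num.Theory.

Local Open Scope classical_set_scope.
Local Open Scope ring_scope.

(** Kleene's schemes; [recfun k] is the syntax of [k]-ary partial recursive
    functions. *)
Inductive recfun : nat -> Type :=
| rzero k : recfun k
| rsucc : recfun 1
| rproj k (i : 'I_k) : recfun k
| rcomp k m (f : recfun m) (g : 'I_m -> recfun k) : recfun k
| rprec k (f : recfun k) (g : recfun k.+2) : recfun k.+1
| rmu k (f : recfun k.+1) : recfun k.

(** [computes f v y]: [f] halts on the arguments [v] with value [y].  The
    recursion variable of [rprec] and the search variable of [rmu] are the first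
    arguments; the step function of [rprec] receives the stage, the previous
    value and the parameters, in this order. *)
Fixpoint computes k (f : recfun k) : k.-tuple nat -> nat -> Prop :=
  match f in recfun k return k.-tuple nat -> nat -> Prop with
  | rzero _ => fun _ y => y = 0%N
  | rsucc => fun v y => y = (thead v).+1
  | rproj _ i => fun v y => y = tnth v i
  | rcomp _ m f g => fun v y => exists w : m.-tuple nat,
      (forall i, computes (g i) v (tnth w i)) /\ computes f w y
  | rprec _ f g => fun v y =>
      (fix stage n z : Prop :=
         if n is n'.+1 then
           exists w, stage n' w /\ computes g [tuple of n' :: w :: behead v] z
         else computes f [tuple of behead v] z) (thead v) y
  | rmu _ f => fun v y => computes f [tuple of y :: v] 0%N /\
      forall z, (z < y)%N -> exists w, computes f [tuple of z :: v] w.+1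
  end.

Lemma computes_functional k (f : recfun k) v y z :
  computes f v y -> computes f v z -> y = z.
Proof.
elim: f v y z => {k} [k|//|k i|k m f IHf g IHg|k f IHf g IHg|k f IHf] v y z /=.
- by move=> -> ->.
- by move=> -> ->.
- by move=> -> ->.
- move=> [w [gw fw]] [w' [gw' fw']]; apply: IHf fw _.
  suff -> : w = w' by [].
  by apply: eq_from_tnth => i; exact: IHg (gw i) (gw' i).
- elim: (thead v) y z => [|n IHn] y z; first exact: IHf.
  by move=> [w [sw gw]] [w' [sw' gw']]; apply: IHg gw _; rewrite (IHn _ _ sw sw').
- move=> [fy ny] [fz nz]; case: (ltngtP y z) => // [yz|zy].
    by have [w fw] := nz _ yz; have := IHf _ _ _ fy fw.
  by have [w fw] := ny _ zy; have := IHf _ _ _ fz fw.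
Qed.

(** Bijective base-2 numeration of binary strings, first bit least
    significant. *)
Fixpoint code (x : seq bool) : nat :=
  if x is b :: x' then ((code x').*2 + b).+1 else 0%N.

Lemma code_inj : injective code.
Proof.
elim=> [|a x IH] [|b y] //= [] e; have eab : a = b.
  by move: (congr1 odd e); rewrite !oddD !odd_double !addFb !oddb.
by move: e; rewrite eab => /addIn /double_inj /IH ->.
Qed.

Lemma code_surj n : exists x, code x = n.
Proof.
elim/ltn_ind: n => -[|n] IH; first by exists [::].
have [|x xE] := IH n./2; first by rewrite ltnS -divn2 leq_div.
by exists (odd n :: x); rewrite /= xE addnC odd_double_half.
Qed.

(** Since [code] is a bijection between binary strings and [nat], the unary
    partial recursive functions are exactly the partial computable functions on
    binary strings. *)
Definition machine := recfun 1.

Definition run (M : machine) (p x : seq bool) : Prop :=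
  computes M [tuple code p] (code x).

Definition prefix_free (M : machine) : Prop :=
  forall p q x y, run M p x -> run M q y -> prefix p q -> p = q.

(** Additive optimality among the machines in [S].  Every machine that is
    universal by adjunction, i.e. simulates each [M] in [S] on programs prefixed
    by a fixed word depending on [M], is optimal in this sense. *)
Definition optimal_in (S : set machine) (U : machine) : Prop :=
  S U /\ forall M, S M -> exists c : nat, forall p x, run M p x ->
    exists q, run U q x /\ (size q <= size p + c)%N.

Definition universal : machine -> Prop := optimal_in setT.

Definition prefix_free_universal : machine -> Prop := optimal_in prefix_free.

(** Plain complexity if [U] is [universal], prefix-free complexity if [U] is
    [prefix_free_universal]; in both cases every string has a program, so the
    value [+oo] of the infimum of the empty set does not occur. *)
Definition complexity (R : realType) (U : machine) (x : seq bool) : \bar R :=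
  ereal_inf [set ((size p)%:R)%:E | p in [set p | run U p x]].

(** The string representing the natural number [n]. *)
Definition zeros (n : nat) : seq bool := nseq n false.

Definition length_normalized (R : realType) (U : machine) : Prop :=
  forall x, (complexity R U (zeros (size x)) <= complexity R U x)%E.

(** Cantor space with its Borel sigma-algebra. *)
Definition cantor := g_sigma_algebraType (@open cantor_space).

HB.instance Definition _ := Measurable.on cantor.

Definition cylinder (x : seq bool) : set cantor :=
  [set Z | forall i, (i < size x)%N -> Z i = nth false x i].

Lemma open_cylinder x : @open cantor_space (cylinder x).
Proof.
have -> : cylinder x = \bigcap_(i in `I_(size x))
    ((fun Z : cantor_space => Z i) @^-1` [set nth false x i]) by [].
rewrite bigcap_mkord.
elim: (size x) => [|n IHn]; first by rewrite big_ord0; exact: openT.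
rewrite big_ord_recr /=; apply: openI => //.
apply: open_comp; last exact: discrete_open.
by move=> Z _; exact: (@proj_continuous _ (fun=> bool)).
Qed.

Lemma measurable_cylinder x : measurable (cylinder x).
Proof. by apply: sub_sigma_algebra; exact: open_cylinder. Qed.

Lemma open_bigcup_cylinder (A : set cantor) : @open cantor_space A ->
  A = \bigcup_(x in [set x | cylinder x `<=` A]) cylinder x.
Proof.
move=> oA; apply/seteqP; split=> [Z AZ|Z [x /= xA]]; last exact: xA.
pose cyl n := cylinder (mkseq Z n).
have cylE n Y : cyl n Y <-> forall i, (i < n)%N -> Y i = Z i.
  by rewrite /cyl /cylinder /= size_mkseq; split=> YZ i ilt;
    have := YZ i ilt; rewrite nth_mkseq.
have cylZ n : cyl n Z by apply/cylE.
have Fcyl : Filter (filter_from [set: nat] cyl).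
  apply: filter_from_filter; first by exists 0%N.
  move=> i j _ _; exists (maxn i j) => // Y /cylE YZ; split; apply/cylE => k klt;
    by apply: YZ; rewrite leq_max klt ?orbT.
have cylcvg : filter_from [set: nat] cyl --> (Z : cantor_space).
  rewrite cvg_sup => i U; rewrite nbhsE => -[B [[C _ <-] /= CZ] BU].
  exists i.+1 => // Y /cylE YZ; apply: BU.
  by have := YZ i (ltnSn i) => /= YZi; rewrite /preimage /= /proj YZi.
have /cylcvg [n _ cylA] : nbhs (Z : cantor_space) A by exact: open_nbhs_nbhs.
by exists (mkseq Z n); [exact: cylA|exact: cylZ].
Qed.

Definition interleave (Z : cantor * cantor) : cantor :=
  fun n => if odd n then Z.2 n./2 else Z.1 n./2.

Lemma measurable_interleave : measurable_fun [set: cantor * cantor] interleave.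
Proof.
have mcoord n b : measurable [set Z : cantor | Z n = b].
  apply: sub_sigma_algebra.
  apply: (@open_comp _ _ (fun Z : cantor_space => Z n) [set b]).
    by move=> Z _; exact: (@proj_continuous _ (fun=> bool)).
  exact: discrete_open.
apply: measurability => // _ [A oA <-]; rewrite setTI.
rewrite (open_bigcup_cylinder oA) bigcup_mkcond preimage_bigcup.
apply: countable_bigcupT_measurable; first exact: countableP.
move=> x; case: ifP => _; last by rewrite preimage_set0.
have -> : cylinder x = \bigcap_(i in `I_(size x)) [set Z | Z i = nth false x i].
  by [].
rewrite preimage_bigcap; apply: bigcap_measurableType => i _.
rewrite /interleave /preimage /=; case: (odd i).
  rewrite -[X in measurable X]setTI.
  exact: (measurable_snd measurableT _ (mcoord i./2 (nth false x i))).
rewrite -[X in measurable X]setTI.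
exact: (measurable_fst measurableT _ (mcoord i./2 (nth false x i))).
Qed.

HB.instance Definition _ :=
  isMeasurableFun.Build _ _ _ _ interleave measurable_interleave.

(** The product measure, transported to Cantor space along [interleave]. *)
Definition product_probability (R : realType) (mu nu : probability cantor R) :
    probability cantor R :=
  distribution (mu \x nu)%E interleave.

Definition mean_complexity (R : realType) (U : machine)
    (mu : probability cantor R) (n : nat) : \bar R :=
  (\sum_(x : n.-tuple bool) complexity R U x * mu (cylinder x))%E.

Definition trivial_for (R : realType) (U : machine)
    (mu : probability cantor R) : Prop :=
  exists c : nat, forall n,
    (mean_complexity U mu n <= complexity R U (zeros n) + c%:R%:E)%E.

(* Main.v *)
(** A string [x] is described from a shortest program [p] for [|x|] (or for a
    length computable from [|x|] and conversely) by the rank of a shortest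
    program for [x] among all programs of the same length with outputs of length
    [|x|].  By Chaitin's counting argument this rank is [2^O(d)] with
    [d = K(x) - K(|x|)]: lengths [m] having [2^(3 d)] programs of length [t] can
    be given codewords of length [t - d + O(1)], because Kraft's inequality for
    the universal machine bounds their total weight.  Hence, [x] and [y] being
    the two halves of a string of length [n],
    [K(x (+) y) <= K(n) + 8 (K(x) - K(|x|)) + 8 (K(y) - K(|y|)) + O(1)], and
    integrating against [mu \x nu] gives the result, as the two differences have
    bounded means.  Only a linear bound in the differences is needed, so no sharp
    symmetry of information enters.  The plain case is the same argument, since
    the programs of one fixed length always form a prefix-free set. *)

Require Import Defs.
From mathcomp Require Import all_boot all_order all_algebra.
From mathcomp Require Import all_classical all_reals all_analysis.
From mathcomp Require Import zify ring lra.

Set Implicit Arguments.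
Unset Strict Implicit.
Unset Printing Implicit Defensive.

(* MathComp-Analysis exports another [code]. *)
Local Notation code := Defs.code.

(** * Total computable functions *)

(* Total functions are viewed as functions of an infinite environment [e], of
   which a [k]-ary program reads the values [e 0], ..., [e k.-1]; binding a
   variable is then composition with [scons], whatever the arity. *)
Definition args k (e : nat -> nat) : k.-tuple nat := [tuple e i | i < k].

Definition scons a (e : nat -> nat) : nat -> nat :=
  fun i => if i is j.+1 then e j else a.

Definition computable (F : (nat -> nat) -> nat) : Prop :=
  exists k (f : recfun k), forall e, computes f (args k e) (F e).

Lemma args_scons k a e : args k.+1 (scons a e) = [tuple of a :: args k e].
Proof.
apply: eq_from_tnth => i; rewrite tnth_mktuple.
case: (unliftP ord0 i) => [j|] ->; last by rewrite tnth0.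
by rewrite tnthS tnth_mktuple.
Qed.

Lemma scons_eta (e : nat -> nat) : scons (e 0) (fun i => e i.+1) = e.
Proof. by apply: funext => -[]. Qed.

Lemma behead_args k e :
  [tuple of behead (args k.+1 e)] = args k (fun i => e i.+1).
Proof. by rewrite -[e in LHS]scons_eta args_scons; apply: val_inj. Qed.

Lemma thead_args k e : thead (args k.+1 e) = e 0.
Proof. by rewrite /thead tnth_mktuple. Qed.

(** Out-of-range indices read as [0], so a program of one arity can be run on a tuple of any other
    length. *)
Definition proj_or_zero n i : recfun n :=
  if insub i is Some j then rproj j else rzero n.

Lemma computes_proj_or_zero n i (v : n.-tuple nat) :
  computes (proj_or_zero n i) v (nth 0 v i).
Proof.
rewrite /proj_or_zero; case: insubP => [j _ <- | ].
  by rewrite /= (tnth_nth 0).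
by rewrite -leqNgt => ni; rewrite /= nth_default ?size_tuple.
Qed.

Lemma nth_args k e i : i < k -> nth 0 (args k e) i = e i.
Proof. by move=> ik; rewrite -[i]/(val (Ordinal ik)) -tnth_nth tnth_mktuple. Qed.

Lemma computable_arity_nth n F : computable F ->
  exists g : recfun n, forall v : n.-tuple nat, computes g v (F (nth 0 v)).
Proof.
move=> [k [f fF]]; exists (rcomp f (fun i : 'I_k => proj_or_zero n i)) => v /=.
exists (args k (nth 0 v)); split; last exact: fF.
by move=> i; rewrite tnth_mktuple; exact: computes_proj_or_zero.
Qed.

(** Covering all large arities at once allows several programs to be brought to a common arity, as
    [rcomp] and [rprec] demand. *)
Lemma computable_arity F : computable F ->
  exists k, forall n, k <= n ->
    exists g : recfun n, forall e, computes g (args n e) (F e).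
Proof.
move=> [k [f fF]]; exists k => n kn.
exists (rcomp f (fun i : 'I_k => proj_or_zero n i)) => e /=.
exists (args k e); split; last exact: fF.
move=> i; rewrite tnth_mktuple -(@nth_args n) ?(leq_trans (ltn_ord i))//.
exact: computes_proj_or_zero.
Qed.

Lemma computable_family (A : nat -> (nat -> nat) -> nat) k :
  (forall i, computable (A i)) ->
  exists n (g : 'I_k -> recfun n), forall i e, computes (g i) (args n e) (A i e).
Proof.
move=> cA.
have [n nP] : exists n, forall i, i < k -> forall m, n <= m ->
    exists g : recfun m, forall e, computes g (args m e) (A i e).
  elim: k => [|k [n nP]]; first by exists 0.
  have [m mP] := computable_arity (cA k).
  exists (maxn n m) => i; rewrite ltnS leq_eqVlt => /orP[/eqP ->|ik] j.
    by rewrite geq_max => /andP[_ /mP].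
  by rewrite geq_max => /andP[/(nP _ ik)].
exists n; have /choice [g gP] : forall i : 'I_k, exists g : recfun n,
    forall e, computes g (args n e) (A i e) by move=> i; exact: nP.
by exists g.
Qed.

(** Infinitely many [A i] are substituted, but a program for [F] reads only the first [k] values, so
    finitely many programs suffice. *)
Lemma computable_subst F (A : nat -> (nat -> nat) -> nat) :
  computable F -> (forall i, computable (A i)) ->
  computable (fun e => F (fun i => A i e)).
Proof.
move=> [k [f fF]] /computable_family -/(_ k) [n [g gA]].
exists n, (rcomp f g) => e /=; exists (args k (fun i => A i e)).
by split=> // i; rewrite tnth_mktuple.
Qed.

Lemma computable_var i : computable (fun e => e i).
Proof. by exists i.+1, (rproj ord_max) => e; rewrite /= tnth_mktuple. Qed.

Lemma computable_const a : computable (fun=> a).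
Proof.
elim: a => [|a [k [f fa]]]; first by exists 0, (rzero 0).
exists k, (rcomp rsucc (fun=> f)) => e /=; exists (args 1 (fun=> a)).
by split=> [i|]; rewrite ?tnth_mktuple ?thead_args.
Qed.

Lemma computable_app1 (f : nat -> nat) A :
  computable (fun e => f (e 0)) -> computable A -> computable (fun e => f (A e)).
Proof. by move=> cf cA; apply: (computable_subst (A := fun=> A) cf). Qed.

Lemma computable_app2 (f : nat -> nat -> nat) A B :
  computable (fun e => f (e 0) (e 1)) -> computable A -> computable B ->
  computable (fun e => f (A e) (B e)).
Proof.
move=> cf cA cB.
by apply: (computable_subst (A := fun i => if i == 0 then A else B) cf) => -[].
Qed.

Lemma computable_app3 (f : nat -> nat -> nat -> nat) A B C :
  computable (fun e => f (e 0) (e 1) (e 2)) ->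
  computable A -> computable B -> computable C ->
  computable (fun e => f (A e) (B e) (C e)).
Proof.
move=> cf cA cB cC.
by apply: (computable_subst
  (A := fun i => if i == 0 then A else if i == 1 then B else C) cf) => -[|[]].
Qed.

Lemma computable_succ A : computable A -> computable (fun e => (A e).+1).
Proof.
apply: (@computable_app1 succn); exists 1, rsucc => e.
by rewrite /= thead_args.
Qed.

Lemma computable_rec (N B : (nat -> nat) -> nat)
    (S : nat -> nat -> (nat -> nat) -> nat) :
  computable N -> computable B ->
  computable (fun e => S (e 0) (e 1) (fun i => e i.+2)) ->
  computable (fun e => nat_rect (fun=> nat) (B e) (fun i a => S i a e) (N e)).
Proof.
move=> cN cB cS.
(* It is enough to recurse on variable [0], with the parameters shifted by one; [N] is then
   substituted for that variable. *)
suff c : computable (fun e => nat_rect (fun=> nat) (B (fun i => e i.+1))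
    (fun i a => S i a (fun i => e i.+1)) (e 0)).
  apply: (computable_subst
    (A := fun i => if i is j.+1 then fun e => e j else N) c) => -[//|j].
  exact: computable_var.
have [k kP] := computable_arity cB; have [m mP] := computable_arity cS.
have [f fB] := kP (maxn k m) (leq_maxl _ _).
have [|g gS] := mP (maxn k m).+2; first by rewrite 2?leqW ?leq_maxr.
exists (maxn k m).+1, (rprec f g) => e /=.
rewrite behead_args thead_args.
elim: (e 0) => [|n IHn] /=; first exact: fB.
eexists; split; first exact: IHn.
set w := nat_rect _ _ _ _.
have -> : [tuple of n :: w :: behead (args (maxn k m).+1 e)]
    = args (maxn k m).+2 (scons n (scons w (fun i => e i.+1))).
  rewrite !args_scons; apply: val_inj => /=.
  by have := congr1 val (behead_args (maxn k m) e) => /= ->.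
exact: gS.
Qed.

Lemma computable_add A B :
  computable A -> computable B -> computable (fun e => A e + B e).
Proof.
move=> cA cB; have := computable_rec (S := fun _ a _ => a.+1) cA cB
  (computable_succ (computable_var 1)).
congr computable; apply: funext => e; elim: (A e) => //= n ->.
by rewrite addSn.
Qed.

Lemma computable_pred A : computable A -> computable (fun e => (A e).-1).
Proof.
move=> cA; have := computable_rec (S := fun i _ _ => i) cA (computable_const 0)
  (computable_var 0).
by congr computable; apply: funext => e; case: (A e).
Qed.

Lemma computable_sub A B :
  computable A -> computable B -> computable (fun e => A e - B e).
Proof.
move=> cA cB; have := computable_rec (S := fun _ a _ => a.-1) cB cA
  (computable_pred (computable_var 1)).
congr computable; apply: funext => e; elim: (B e) => [|n /= ->].
  by rewrite subn0.
by rewrite subnS.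
Qed.

Lemma computable_mul A B :
  computable A -> computable B -> computable (fun e => A e * B e).
Proof.
move=> cA cB; apply: (@computable_app2 muln) => //.
have := computable_rec (S := fun _ a e => a + e 1) (computable_var 0)
  (computable_const 0) (computable_add (computable_var 1) (computable_var 3)).
congr computable; apply: funext => e; elim: (e 0) => //= n ->.
by rewrite mulSnr.
Qed.

Lemma computable_exp A B :
  computable A -> computable B -> computable (fun e => A e ^ B e).
Proof.
move=> cA cB; apply: (@computable_app2 expn) => //.
have := computable_rec (S := fun _ a e => a * e 0) (computable_var 1)
  (computable_const 1) (computable_mul (computable_var 1) (computable_var 2)).
congr computable; apply: funext => e; elim: (e 1) => //= n ->.
by rewrite expnSr.
Qed.

Lemma computable_leq A B :
  computable A -> computable B -> computable (fun e => A e <= B e).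
Proof.
move=> cA cB; have := computable_sub (computable_const 1) (computable_sub cA cB).
by congr computable; apply: funext => e; rewrite /leq; case: (A e - B e).
Qed.

Lemma computable_and (P Q : (nat -> nat) -> bool) :
  computable P -> computable Q -> computable (fun e => P e && Q e).
Proof.
move=> cP cQ; have := computable_mul cP cQ.
by congr computable; apply: funext => e; rewrite mulnb.
Qed.

Lemma computable_neg (P : (nat -> nat) -> bool) :
  computable P -> computable (fun e => ~~ P e).
Proof.
move=> cP; have := computable_sub (computable_const 1) cP.
by congr computable; apply: funext => e; case: (P e).
Qed.

Lemma computable_or (P Q : (nat -> nat) -> bool) :
  computable P -> computable Q -> computable (fun e => P e || Q e).
Proof.
move=> cP cQ.
have := computable_neg (computable_and (computable_neg cP) (computable_neg cQ)).
by congr computable; apply: funext => e; rewrite negb_and !negbK.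
Qed.

Lemma computable_eq A B :
  computable A -> computable B -> computable (fun e => A e == B e).
Proof.
move=> cA cB.
have := computable_and (computable_leq cA cB) (computable_leq cB cA).
by congr computable; apply: funext => e; rewrite -eqn_leq.
Qed.

Lemma computable_if (P : (nat -> nat) -> bool) A B :
  computable P -> computable A -> computable B ->
  computable (fun e => if P e then A e else B e).
Proof.
move=> cP cA cB; have := computable_add (computable_mul cP cA)
  (computable_mul (computable_neg cP) cB).
congr computable; apply: funext => e; case: (P e) => /=.
  by rewrite mul1n mul0n addn0.
by rewrite mul1n mul0n add0n.
Qed.

Lemma computable_sum N (F : nat -> (nat -> nat) -> nat) :
  computable N -> computable (fun e => F (e 0) (fun i => e i.+1)) ->
  computable (fun e => \sum_(0 <= i < N e) F i e).
Proof.
move=> cN cF.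
have cS : computable (fun e => e 1 + F (e 0) (fun i => e i.+2)).
  apply: computable_add; first exact: computable_var.
  apply: (computable_subst
    (A := fun i e => if i is j.+1 then e j.+2 else e 0) cF) => -[|j];
    exact: computable_var.
have := computable_rec (S := fun i a e => a + F i e) cN (computable_const 0) cS.
congr computable; apply: funext => e; elim: (N e) => [|n IHn].
  by rewrite big_geq.
by rewrite /= IHn big_nat_recr.
Qed.

Lemma computable_sum_cond N (P : nat -> (nat -> nat) -> bool)
    (F : nat -> (nat -> nat) -> nat) :
  computable N -> computable (fun e => P (e 0) (fun i => e i.+1)) ->
  computable (fun e => F (e 0) (fun i => e i.+1)) ->
  computable (fun e => \sum_(0 <= i < N e | P i e) F i e).
Proof.
move=> cN cP cF; have cPF := computable_if cP cF (computable_const 0).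
have := computable_sum (F := fun i e => if P i e then F i e else 0) cN cPF.
by congr computable; apply: funext => e; rewrite [RHS]big_mkcond.
Qed.

(** For a nonzero divisor, the quotient counts its positive multiples that do not exceed the
    dividend. *)
Lemma computable_div A B :
  computable A -> computable B -> computable (fun e => A e %/ B e).
Proof.
move=> cA cB; apply: (@computable_app2 divn) => //.
have -> : (fun e => e 0 %/ e 1) = (fun e : nat -> nat =>
    if e 1 == 0 then 0 else \sum_(0 <= i < e 0) (i.+1 * e 1 <= e 0)).
  apply: funext => e; case: eqP => [->|/eqP e1]; first by rewrite divn0.
  have -> : \sum_(0 <= i < e 0) (i.+1 * e 1 <= e 0)
      = \sum_(0 <= i < e 0) (i < e 0 %/ e 1).
    by apply: eq_big_nat => i _; rewrite leq_divRL ?lt0n.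
  rewrite (big_cat_nat_idem _ (n := e 0 %/ e 1)) ?leq_div//=.
  rewrite (eq_big_nat _ _ (F2 := fun=> 1)) => [|i /andP[_ ->]//].
  rewrite sum_nat_const_nat muln1 subn0 big_nat big1 ?addn0// => i /andP[+ _].
  by rewrite leqNgt => /negbTE ->.
apply: computable_if; first by apply: computable_eq;
  [exact: computable_var | exact: computable_const].
  exact: computable_const.
apply: (computable_sum (F := fun i e => i.+1 * e 1 <= e 0));
  first exact: computable_var.
apply: computable_leq; last exact: computable_var.
by apply: computable_mul; [apply: computable_succ|]; exact: computable_var.
Qed.

Lemma computable_odd A : computable A -> computable (fun e => odd (A e)).
Proof.
move=> cA; have := computable_sub cA (computable_mul (computable_const 2)
  (computable_div cA (computable_const 2))).
congr computable; apply: funext => e.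
by rewrite {1}(divn_eq (A e) 2) mulnC addKn modn2.
Qed.

Lemma computable_half A : computable A -> computable (fun e => (A e)./2).
Proof.
move=> cA; have := computable_div cA (computable_const 2).
by congr computable; apply: funext => e; rewrite divn2.
Qed.

Lemma computable_uphalf A : computable A -> computable (fun e => uphalf (A e)).
Proof. by move=> /computable_succ/computable_half. Qed.

Lemma computable_double A : computable A -> computable (fun e => (A e).*2).
Proof.
move=> cA; have := computable_add cA cA.
by congr computable; apply: funext => e; rewrite addnn.
Qed.

(** A hook of [comp], rebound as further operations are shown computable. *)
Ltac comp_extra := fail.

Ltac comp_step :=
  cbv beta iota delta [scons];
  first [exact: computable_const | assumption | lazymatch goal with
  | |- computable (fun e => e _) => exact: computable_var
  | |- computable (fun e => S _) => apply: computable_succ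
  | |- computable (fun e => addn _ _) => apply: computable_add
  | |- computable (fun e => subn _ _) => apply: computable_sub
  | |- computable (fun e => muln _ _) => apply: computable_mul
  | |- computable (fun e => expn _ _) => apply: computable_exp
  | |- computable (fun e => predn _) => apply: computable_pred
  | |- computable (fun e => divn _ _) => apply: computable_div
  | |- computable (fun e => half _) => apply: computable_half
  | |- computable (fun e => uphalf _) => apply: computable_uphalf
  | |- computable (fun e => double _) => apply: computable_double
  | |- computable (fun e => nat_of_bool (leq _ _)) => apply: computable_leq
  | |- computable (fun e => nat_of_bool (eq_op _ _)) => apply: computable_eq
  | |- computable (fun e => nat_of_bool (andb _ _)) => apply: computable_and
  | |- computable (fun e => nat_of_bool (orb _ _)) => apply: computable_or
  | |- computable (fun e => nat_of_bool (negb _)) => apply: computable_neg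
  | |- computable (fun e => nat_of_bool (odd _)) => apply: computable_odd
  | |- computable (fun e => if _ then _ else _) => apply: computable_if
  | |- _ => comp_extra
  end].

Ltac comp := repeat comp_step.

Lemma computable_prod_family (A : nat -> (nat -> nat) -> nat) m :
  (forall i, computable (A i)) -> computable (fun e => \prod_(i < m) A i e).
Proof.
move=> cA; elim: m => [|m IHm].
  have := computable_const 1.
  by congr computable; apply: funext => e; rewrite big_ord0.
have := computable_mul IHm (cA m).
by congr computable; apply: funext => e; rewrite big_ord_recr.
Qed.

(* [T s e] is [y.+1] if [f] halts with value [y] within [s] stages, else [0]. *)
Definition evaluates k (f : recfun k) (T : nat -> (nat -> nat) -> nat) : Prop :=
  [/\ computable (fun e => T (e 0) (fun i => e i.+1)),
      forall s e y, T s e = y.+1 -> computes f (args k e) y,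
      forall e y, computes f (args k e) y -> exists s, T s e = y.+1 &
      forall s s' e y, T s e = y.+1 -> s <= s' -> T s' e = y.+1].

Lemma evaluates_total k (f : recfun k) F :
  (forall e, computes f (args k e) (F e)) -> computable F ->
  evaluates f (fun _ e => (F e).+1).
Proof.
move=> fF cF; split.
- apply: computable_succ.
  by apply: (computable_subst (A := fun i e => e i.+1) cF) => i; comp.
- by move=> _ e y [<-].
- by move=> e y /computes_functional/(_ (fF e)) ->; exists 0.
- by [].
Qed.

Lemma computable_tail T (A : nat -> (nat -> nat) -> nat) B :
  computable (fun e => T (e 0) (fun i => e i.+1)) ->
  computable B -> (forall i, computable (A i)) ->
  computable (fun e => T (B e) (fun i => A i e)).
Proof.
move=> cT cB cA.
by apply: (computable_subst (A := fun i => if i is j.+1 then A j else B) cT) => -[|j].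
Qed.

(** By stage [s] all the [g i] have halted exactly when the product of their shifted values is
    positive; only then is [f] tried. *)
Lemma evaluates_comp k m (f : recfun m) (g : 'I_m -> recfun k) :
  (exists T, evaluates f T) -> (forall i, exists T, evaluates (g i) T) ->
  exists T, evaluates (rcomp f g) T.
Proof.
move=> [T [cT sT eT mT]] /choice [G GP].
(* An environment has infinitely many entries; those beyond [m] are [0] at every stage, so they
   cannot disturb [T]. *)
pose H i := if insub i is Some j then G j else fun _ _ => 0.
have HE (i : 'I_m) : H i = G i.
  by rewrite /H; case: insubP => [j _ /val_inj -> //|]; rewrite ltn_ord.
have cH i : computable (fun e => H i (e 0) (fun j => e j.+1)).
  by rewrite /H; case: insubP => [j _ _|_]; [case: (GP j)|comp].
have HP s e : 0 < \prod_(i < m) H i s e <-> forall i : 'I_m, 0 < G i s e.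
  split=> [+ i|G0]; first by rewrite (bigD1 i)//= muln_gt0 HE => /andP[].
  by apply: prodn_cond_gt0 => i _; rewrite HE.
have wE s e (w : m.-tuple nat) : (forall i, G i s e = (tnth w i).+1) ->
    w = args m (fun i => (H i s e).-1).
  by move=> Gw; apply: eq_from_tnth => i; rewrite tnth_mktuple HE Gw.
exists (fun s e => if 0 < \prod_(i < m) H i s e
  then T s (fun i => (H i s e).-1) else 0); split.
- apply: computable_if; last by comp.
    apply: computable_leq; first by comp.
    exact: (computable_prod_family (A := fun i e => H i (e 0) (fun j => e j.+1))).
  apply: computable_tail => //; first by comp.
  by move=> i; comp; exact: cH.
- move=> s e y; case: ifP => // /HP G0 Ty.
  exists (args m (fun i => (H i s e).-1)); split; last exact: sT Ty.
  move=> i; rewrite tnth_mktuple HE; case: (GP i) => _ + _ _; apply.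
  by rewrite prednK.
- move=> e y [w [gw fw]].
  have /choice [r rP] : forall i : 'I_m, exists s, G i s e = (tnth w i).+1.
    by move=> i; case: (GP i) => _ _ + _; apply; exact: gw.
  pose s0 := \max_(i < m) r i.
  have Gw s : s0 <= s -> forall i, G i s e = (tnth w i).+1.
    move=> ss i; case: (GP i) => _ _ _ /(_ _ s _ _ (rP i)); apply.
    exact: leq_trans (leq_bigmax i) ss.
  move: fw; rewrite (wE _ _ _ (Gw _ (leqnn s0))) => /eT [s1 Ty].
  exists (maxn s0 s1); have Gm := Gw _ (leq_maxl s0 s1).
  rewrite ifT; last by apply/HP => i; rewrite Gm.
  apply: mT (leq_maxr s0 s1); rewrite -Ty; congr T.
  apply: funext => i; case: (ltnP i m) => im; last first.
    by rewrite /H insubF ?ltnNge ?im.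
  by rewrite -[i]/(val (Ordinal im)) !HE (Gw _ (leqnn s0)) Gm.
- move=> s s' e y; case: ifP => // /HP G0 Ty ss.
  have Gs (i : 'I_m) : G i s' e = G i s e.
    case: (GP i) => _ _ _ /(_ s s' e (G i s e).-1).
    by rewrite prednK //; apply.
  rewrite ifT; last by apply/HP => i; rewrite Gs.
  rewrite -(mT _ _ _ _ Ty ss); congr T.
  apply: funext => i; case: (ltnP i m) => im; last first.
    by rewrite /H insubF ?ltnNge ?im.
  by rewrite -[i]/(val (Ordinal im)) !HE Gs.
Qed.

Lemma evaluates_prec k (f : recfun k) (g : recfun k.+2) :
  (exists T, evaluates f T) -> (exists T, evaluates g T) ->
  exists T, evaluates (rprec f g) T.
Proof.
move=> [T [cT sT eT mT]] [G [cG sG eG mG]].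
(* The value [0], meaning not yet halted, is passed on through all later recursion steps. *)
pose step s e i a :=
  if a == 0 then 0 else G s (scons i (scons a.-1 (fun j => e j.+1))).
pose R s e n := nat_rect (fun=> nat) (T s (fun j => e j.+1)) (step s e) n.
have tupleE n w e : [tuple of n :: w :: behead (args k.+1 e)]
    = args k.+2 (scons n (scons w (fun i => e i.+1))).
  rewrite !args_scons; apply: val_inj => /=.
  by have := congr1 val (behead_args k e) => /= ->.
have mR s s' e n y : R s e n = y.+1 -> s <= s' -> R s' e n = y.+1.
  move=> + ss; elim: n y => [|n IHn] y /=; first by move/mT; exact.
  rewrite /step; case RE: (R s e n) => [|z]//=.
  by rewrite (IHn _ RE)/= => /mG; exact.
exists (fun s e => R s e (e 0)); split.
- apply: (computable_rec (S := fun i a e => step (e 0) (fun j => e j.+1) i a)).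
  + by comp.
  + by apply: computable_tail => //; comp => i; comp.
  + rewrite /step; apply: computable_if; [by comp | by comp |].
    apply: computable_tail => //; first by comp.
    by move=> [|[|i]]; comp.
- move=> s e; rewrite /= thead_args behead_args.
  elim: (e 0) => [|n IHn] y /=; first exact: sT.
  rewrite /step; case RE: (R s e n) => [|z]//= /sG; rewrite -tupleE => gy.
  by exists z; split=> //; exact: IHn.
- move=> e; rewrite /= thead_args behead_args.
  elim: (e 0) => [|n IHn] y /=; first exact: eT.
  move=> [z [/IHn[s1 s1P]]]; rewrite tupleE => /eG[s2 s2P].
  exists (maxn s1 s2); rewrite /step (mR _ _ _ _ _ s1P (leq_maxl s1 s2))/=.
  exact: mG s2P (leq_maxr s1 s2).
- by move=> s s' e y; exact: mR.
Qed.

Lemma evaluates_mu k (f : recfun k.+1) :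
  (exists T, evaluates f T) -> exists T, evaluates (rmu f) T.
Proof.
move=> [T [cT sT eT mT]].
(* Because of the shift, [1] means halting with value [0], and [2] or more halting with a nonzero
   value. The sum counts the smaller [z] for which the latter is not yet known. *)
pose found s e y := (T s (scons y e) == 1) &&
  (\sum_(0 <= z < y) (T s (scons z e) <= 1) == 0).
have foundP s e y : reflect
    (T s (scons y e) = 1 /\ forall z, z < y -> exists w, T s (scons z e) = w.+2)
    (found s e y).
  rewrite /found sum_nat_seq_eq0; apply: (iffP andP) => -[fy h]; split.
  - exact/eqP.
  - move=> z zy; have /(allP h)/= : z \in index_iota 0 y by rewrite mem_index_iota.
    by case: (T s (scons z e)) => [|[|w]] // _; exists w.
  - exact/eqP.
  - by apply/allP => z; rewrite mem_index_iota => /andP[_ /h[w ->]].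
have found_uniq s e y z : found s e y -> found s e z -> y = z.
  move=> /foundP[fy hy] /foundP[fz hz]; case: (ltngtP y z) => // [/hz|/hy] [w].
    by rewrite fy.
  by rewrite fz.
(* At most one term is nonzero, so the sum is the zero that was found, shifted by one. *)
have TE s e y : \sum_(0 <= i < s) i.+1 * found s e i = y.+1 <->
    y < s /\ found s e y.
  split=> [|[ys fy]]; last first.
    rewrite (bigD1_seq y) ?mem_index_iota ?iota_uniq//= fy muln1 big1 ?addn0//.
    move=> i /eqP iy; case fi: (found s e i); last by rewrite muln0.
    by have := found_uniq _ _ _ _ fi fy.
  have [[z /andP[zs fz]]|no] := pselect (exists z, (z < s) && found s e z).
    rewrite (bigD1_seq z) ?mem_index_iota ?iota_uniq//= fz muln1 big1 ?addn0.
      by move=> [<-].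
    move=> i /eqP iz; case fi: (found s e i); last by rewrite muln0.
    by have := found_uniq _ _ _ _ fi fz.
  rewrite big_nat big1// => i /= si; case fi: (found s e i); last by rewrite muln0.
  by exfalso; apply: no; exists i; rewrite si.
have found_mono s s' e y : found s e y -> s <= s' -> found s' e y.
  move=> /foundP[fy hy] ss; apply/foundP; split; first exact: mT fy ss.
  by move=> z /hy[w wz]; exists w; exact: mT wz ss.
exists (fun s e => \sum_(0 <= i < s) i.+1 * found s e i); split.
- apply: (computable_sum (F := fun i e => i.+1 * found (e 0) (fun j => e j.+1) i));
    first by comp.
  rewrite /found; comp.
  + by apply: computable_tail => //; comp => -[|i]; comp.
  + apply: (computable_sum (F := fun z e => T (e 1) (scons z (fun j => e j.+2)) <= 1));
      first by comp.
    by comp; apply: computable_tail => //; comp => -[|i]; comp.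
- move=> s e y /TE[_ /foundP[fy hy]]; split.
    by have := sT _ _ _ fy; rewrite args_scons.
  by move=> z /hy[w /sT]; rewrite args_scons; exists w.
- move=> e y [fy hy].
  have [s0 s0P] : exists s, T s (scons y e) = 1.
    by apply: eT; rewrite args_scons.
  have [s1 s1P] : exists s, forall z, z < y -> exists w, T s (scons z e) = w.+2.
    elim: y hy {fy s0P} => [|y IHy] hy; first by exists 0.
    have [z zy|s sP] := IHy; first exact/hy/ltnW.
    have [w wP] := hy y (ltnSn y).
    have [|s' s'P] := eT (scons y e) w.+1; first by rewrite args_scons.
    exists (maxn s s') => z; rewrite ltnS leq_eqVlt => /orP[/eqP ->|/sP[v vP]].
      by exists w; exact: mT s'P (leq_maxr s s').
    by exists v; exact: mT vP (leq_maxl s s').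
  exists (maxn y.+1 (maxn s0 s1)); apply/TE; split; first exact: leq_maxl.
  apply/foundP; split; first by apply: mT s0P _; rewrite !leq_max leqnn orbT.
  by move=> z /s1P[w wP]; exists w; apply: mT wP _; rewrite !leq_max leqnn !orbT.
- move=> s s' e y /TE[ys fy] ss; apply/TE; split; first exact: leq_trans ys ss.
  exact: found_mono fy ss.
Qed.

Lemma evaluator k (f : recfun k) : exists T, evaluates f T.
Proof.
elim: f => {k} [k||k i|k m f IHf g IHg|k f IHf g IHg|k f IHf].
- by eexists; apply: (evaluates_total (F := fun=> 0)) => //; comp.
- eexists; apply: (evaluates_total (F := fun e => (e 0).+1)); last by comp.
  by move=> e; rewrite /= thead_args.
- eexists; apply: (evaluates_total (F := fun e => e i)); last by comp.
  by move=> e; rewrite /= tnth_mktuple.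
- exact: evaluates_comp.
- exact: evaluates_prec.
- exact: evaluates_mu.
Qed.

(** Minimization of [~~ P] finds the least witness, and uniqueness makes it the only one; [F] is
    applied to it afterwards. *)
Lemma search_machine (P : nat -> nat -> bool) (F : nat -> nat) :
  computable (fun e => P (e 0) (e 1)) -> computable (fun e => F (e 0)) ->
  (forall w w' q, P w q -> P w' q -> w = w') ->
  exists M : machine, forall q y,
    computes M [tuple q] y <-> exists2 w, P w q & y = F w.
Proof.
move=> cP cF uP.
have [p pP] := computable_arity_nth 2 (computable_neg cP).
have [f fP] := computable_arity_nth 1 cF.
have pE w q : computes p [tuple of w :: [tuple q]] (~~ P w q) by exact: pP.
exists (rcomp f (fun _ : 'I_1 => rmu p)) => q y; split=> /=.
- move=> [v [pv fv]]; exists (tnth v ord0); last first.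
    rewrite (computes_functional fv (fP v)); congr F.
    by rewrite (tnth_nth 0).
  have [p0 _] := pv ord0.
  by have := computes_functional p0 (pE _ _); case: (P _ _).
- move=> [w wq ->]; exists [tuple w]; split; last exact: fP.
  move=> i; rewrite (ord1 i) (tnth_nth 0)/=; split.
    by have := pE w q; rewrite wq.
  move=> z zw; exists 0; have := pE z q.
  by case zq: (P z q) => //; rewrite (uP _ _ _ zq wq) ltnn in zw.
Qed.

(** * Computable operations on strings *)

Definition word n : seq bool := sval (cid (code_surj n)).

Lemma code_word n : code (word n) = n.
Proof. by rewrite /word; case: cid. Qed.

Lemma word_code x : word (code x) = x.
Proof. by apply: code_inj; rewrite code_word. Qed.

(** In binary, [(code x).+1] is a leading [1] followed by the bits of [x] in reverse. This turns
    string operations into arithmetic. *)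
Lemma code_cons b x : (code (b :: x)).+1 = (code x).+1.*2 + b.
Proof. by rewrite /= doubleS !addSn. Qed.

Lemma code_size x : 2 ^ size x <= (code x).+1 < 2 ^ (size x).+1.
Proof.
elim: x => [//|b x IHx]; rewrite code_cons [size _]/= !expnS.
by case: b; move: IHx; rewrite expnS; lia.
Qed.

Lemma code_sum x :
  (code x).+1 = 2 ^ size x + \sum_(0 <= i < size x) nth false x i * 2 ^ i.
Proof.
elim: x => [|b x IHx]; first by rewrite big_geq.
rewrite code_cons IHx [size _]/= big_nat_recl//= muln1 expnS.
rewrite doubleD -!mul2n big_distrr/= (addnC b) addnA; congr (_ + _ + _).
by apply: eq_bigr => i _; rewrite expnS; lia.
Qed.

Lemma nth_code x i :
  nth false x i = (i < size x) && odd ((code x).+1 %/ 2 ^ i) :> bool.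
Proof.
elim: x i => [|b x IHx] i; first by rewrite nth_nil.
rewrite code_cons; case: i => [|i].
  by rewrite expn0 divn1 oddD odd_double oddb.
rewrite -[nth _ _ _]/(nth false x i) IHx -[_ < size _]/(i < size x).
by rewrite expnS divnMA divn2 addnC half_bit_double.
Qed.

Lemma code_cat x y :
  (code (x ++ y)).+1 + 2 ^ size x = (code x).+1 + 2 ^ size x * (code y).+1.
Proof.
elim: x => [|b x IHx]; first by rewrite /=; lia.
by rewrite cat_cons !code_cons [size _]/= expnS; lia.
Qed.

(** The size is the number of [i] with [2 ^ i.+1 <= (code X).+1], and all of these lie below
    [code X]. *)
Lemma computable_size X :
  computable (fun e => code (X e)) -> computable (fun e => size (X e)).
Proof.
move=> cX.
have := computable_sum (F := fun i e => 2 ^ i.+1 <= (code (X e)).+1) cX.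
have sizeE e : \sum_(0 <= i < code (X e)) (2 ^ i.+1 <= (code (X e)).+1) = size (X e).
  have /andP[le lt] := code_size (X e).
  have sc : size (X e) <= code (X e).
    by rewrite -ltnS; apply: leq_trans le; exact: ltn_expl.
  rewrite (big_cat_nat_idem _ (n := size (X e)))//= -[RHS]addn0; congr (_ + _).
    rewrite -[RHS]subn0 -[RHS]muln1 -sum_nat_const_nat.
    apply: eq_big_nat => i /andP[_ ie]; rewrite (leq_trans _ le)//.
    by rewrite leq_exp2l.
  rewrite big_nat big1// => i /andP[ei _]; rewrite leqNgt (leq_trans lt)//.
  by rewrite leq_exp2l.
have -> : (fun e => size (X e)) =
    (fun e => \sum_(0 <= i < code (X e)) (2 ^ i.+1 <= (code (X e)).+1)).
  by apply: funext => e; rewrite sizeE.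
apply; comp.
by apply: (computable_subst (A := fun i e => e i.+1) cX) => i; comp.
Qed.

Ltac comp_string :=
  lazymatch goal with
  | |- computable (fun e => size _) => apply: computable_size
  | |- _ => fail
  end.
Ltac comp_extra ::= comp_string.

Lemma computable_nth X I : computable (fun e => code (X e)) -> computable I ->
  computable (fun e => nth false (X e) (I e)).
Proof.
move=> cX cI.
have -> : (fun e => nth false (X e) (I e) : nat) = (fun e =>
    (I e < size (X e)) && odd ((code (X e)).+1 %/ 2 ^ I e) : nat).
  by apply: funext => e; rewrite -nth_code.
by comp.
Qed.

Lemma computable_cat X Y :
  computable (fun e => code (X e)) -> computable (fun e => code (Y e)) ->
  computable (fun e => code (X e ++ Y e)).
Proof.
move=> cX cY.
have -> : (fun e => code (X e ++ Y e)) = (fun e => ((code (X e)).+1 +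
    2 ^ size (X e) * (code (Y e)).+1 - 2 ^ size (X e)).-1).
  by apply: funext => e; rewrite -code_cat addnK.
by comp.
Qed.

Lemma computable_mkseq N (P : nat -> (nat -> nat) -> bool) :
  computable N -> computable (fun e => P (e 0) (fun i => e i.+1)) ->
  computable (fun e => code (mkseq (fun i => P i e) (N e))).
Proof.
move=> cN cP.
have -> : (fun e => code (mkseq (fun i => P i e) (N e))) = (fun e =>
    (2 ^ N e + \sum_(0 <= i < N e) P i e * 2 ^ i).-1).
  apply: funext => e; rewrite -[LHS]/(_.+1.-1) code_sum size_mkseq.
  congr (_ + _).-1; apply: eq_big_nat => i /andP[_ iN].
  by rewrite nth_mkseq.
comp; apply: (computable_sum (F := fun i e => P i e * 2 ^ i)) => //; comp.
Qed.

Lemma computable_nseq N b :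
  computable N -> computable (fun e => code (nseq (N e) b)).
Proof.
move=> cN.
have -> : (fun e => code (nseq (N e) b)) =
    (fun e => code (mkseq (fun=> b) (N e))).
  apply: funext => e; congr code; apply: (@eq_from_nth _ b).
    by rewrite size_nseq size_mkseq.
  by move=> i; rewrite size_nseq => iN; rewrite nth_nseq iN nth_mkseq.
by apply: computable_mkseq => //; comp.
Qed.

(** * Self-delimiting and fixed-length codes of numbers *)

Definition selfdelim n : seq bool :=
  nseq (size (word n)) true ++ false :: word n.

Lemma size_selfdelim n : size (selfdelim n) = (size (word n)).*2.+1.
Proof. by rewrite size_cat size_nseq /= -addnn addnS. Qed.

(** The run of leading [true] bits announces the length of the word, so the end of the code can be
    recognized from the code itself. *)
Lemma selfdelim_prefix m n x y : prefix (selfdelim m ++ x) (selfdelim n ++ y) ->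
  m = n /\ prefix x y.
Proof.
rewrite /selfdelim -!catA /= => h.
have h' k l (u v : seq bool) :
    prefix (nseq k true ++ false :: u) (nseq l true ++ false :: v) ->
    k = l /\ prefix u v.
  elim: k l => [|k IHk] [|l]; rewrite ?prefix_cons//=.
    by move=> /IHk[-> ->].
have {h h'}[kl h] := h' _ _ _ _ h.
move: h; rewrite prefix_catr// => /andP[/eqP mn ->].
by rewrite -(code_word m) mn code_word.
Qed.

Lemma computable_selfdelim A :
  computable A -> computable (fun e => code (selfdelim (A e))).
Proof.
move=> cA.
have cw : computable (fun e => code (word (A e))).
  by under eq_fun do rewrite code_word.
apply: computable_cat; first by apply: computable_nseq; comp.
have -> : (fun e => code (false :: word (A e))) = (fun e => (A e).*2.+1).
  by apply: funext => e; rewrite /= code_word addn0.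
by comp.
Qed.

(* Most significant bit first, so that prefixes correspond to dyadic
   subintervals. *)
Definition bits k z : seq bool := mkseq (fun i => odd (z %/ 2 ^ (k.-1 - i))) k.

Lemma size_bits k z : size (bits k z) = k.
Proof. exact: size_mkseq. Qed.

Lemma computable_bits K Z :
  computable K -> computable Z -> computable (fun e => code (bits (K e) (Z e))).
Proof.
move=> cK cZ; apply: (@computable_app2 (fun k z => code (bits k z))) => //.
by apply: (computable_mkseq
  (P := fun i e => odd (e 1 %/ 2 ^ ((e 0).-1 - i)))); comp.
Qed.

Lemma bits_inj k y z : y < 2 ^ k -> z < 2 ^ k -> bits k y = bits k z -> y = z.
Proof.
have bitsS l w : bits l.+1 w = rcons (bits l w./2) (odd w).
  rewrite /bits mkseqS subnn divn1; congr rcons.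
  apply: (@eq_from_nth _ false); rewrite !size_mkseq// => i il.
  by rewrite !nth_mkseq//= -divn2 -divnMA -expnS; do 3 f_equal; lia.
elim: k y z => [|k IHk] y z; first by case: y z => [|?] [|?].
rewrite !expnS => yk zk; rewrite !bitsS => /rcons_inj[/IHk half_eq odd_eq].
by rewrite -(odd_double_half y) -(odd_double_half z) odd_eq half_eq //; lia.
Qed.

(** Keeping the first [k] of [l] binary digits is division by [2 ^ (l - k)]: a prefix names a dyadic
    interval containing the other. *)
Lemma bits_prefix k l y z : y < 2 ^ k -> z < 2 ^ l ->
  prefix (bits k y) (bits l z) -> k <= l /\ y = z %/ 2 ^ (l - k).
Proof.
move=> yk zl pre.
have kl : k <= l by have := size_prefix pre; rewrite !size_bits.
split=> //; apply: (@bits_inj k) => //.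
  by rewrite ltn_divLR ?expn_gt0// -expnD subnKC.
move: pre; rewrite prefixE size_bits => /eqP <-.
apply: (@eq_from_nth _ false); rewrite ?size_takel ?size_bits// => i ik.
rewrite nth_take// !nth_mkseq ?(leq_trans ik)//.
by rewrite -divnMA -expnD; do 3 f_equal; lia.
Qed.

(** * Enumeration of the domain of a machine *)

(** A positive integer is uniquely a power of two times an odd number; [nfst] reads the exponent and
    [nsnd] the odd factor. *)
Definition npair a b := (2 ^ a * b.*2.+1).-1.
Definition nfst w := logn 2 w.+1.
Definition nsnd w := (w.+1 %/ 2 ^ nfst w)./2.

Lemma npairS a b : (npair a b).+1 = 2 ^ a * b.*2.+1.
Proof. by rewrite prednK// muln_gt0 expn_gt0. Qed.

Lemma nfst_pair a b : nfst (npair a b) = a.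
Proof.
rewrite /nfst npairS lognM ?expn_gt0// pfactorK// logn_coprime ?addn0//.
by rewrite prime_coprime// dvdn2 /= odd_double.
Qed.

Lemma nsnd_pair a b : nsnd (npair a b) = b.
Proof.
by rewrite /nsnd nfst_pair npairS mulKn ?expn_gt0// /= uphalf_double.
Qed.

Lemma npair_eta w : npair (nfst w) (nsnd w) = w.
Proof.
rewrite /npair /nsnd; set d := w.+1 %/ _.
have dw : d * 2 ^ nfst w = w.+1 by rewrite divnK// pfactor_dvdnn.
have od : odd d.
  have [m om wm] := pfactor_coprime (p := 2) isT (ltn0Sn w).
  rewrite coprime2n in om.
  by move: dw; rewrite [in RHS]wm -/(nfst w) => /eqP;
    rewrite eqn_pmul2r ?expn_gt0// => /eqP ->.
have -> : d./2.*2.+1 = d by rewrite -[RHS]odd_double_half od.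
by rewrite mulnC dw.
Qed.

Lemma leq_nfst w : nfst w <= w.
Proof. by rewrite -ltnS; apply: ltn_logl. Qed.

Lemma computable_nfst A : computable A -> computable (fun e => nfst (A e)).
Proof.
move=> cA; apply: (@computable_app1 nfst) => //.
have -> : (fun e => nfst (e 0)) = (fun e : nat -> nat =>
    \sum_(0 <= i < e 0) ((e 0).+1 %/ 2 ^ i.+1 * 2 ^ i.+1 == (e 0).+1)).
  apply: funext => e; rewrite /nfst logn_count_dvd// big_add1 /=.
  by apply: eq_bigr => i _; rewrite dvdn_eq.
by apply: (computable_sum
  (F := fun i e => (e 0).+1 %/ 2 ^ i.+1 * 2 ^ i.+1 == (e 0).+1)); comp.
Qed.

Lemma computable_nsnd A : computable A -> computable (fun e => nsnd (A e)).
Proof.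
move=> cA; rewrite /nsnd; comp; exact: computable_nfst.
Qed.

Lemma computable_word A :
  computable A -> computable (fun e => code (word (A e))).
Proof. by under eq_fun do rewrite code_word. Qed.

(* Each halting program is listed exactly once. *)
Record enumeration (U : machine) := Enumeration {
  halts : nat -> bool;
  prog : nat -> seq bool;
  out : nat -> seq bool;
  computable_halts : computable (fun e => halts (e 0));
  computable_prog : computable (fun e => code (prog (e 0)));
  computable_out : computable (fun e => code (out (e 0)));
  run_halts : forall w, halts w -> run U (prog w) (out w);
  run_enum : forall p x, run U p x ->
    exists w, [/\ halts w, prog w = p & out w = x];
  prog_inj : forall w w', halts w -> halts w' -> prog w = prog w' -> w = w';
  size_prog : forall w, size (prog w) <= w }.

Lemma enumerate (U : machine) : inhabited (enumeration U).
Proof.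
have [T [cT sT eT mT]] := evaluator U.
pose t s p := T s (fun=> p).
have ct A B : computable A -> computable B -> computable (fun e => t (A e) (B e)).
  by move=> cA cB; apply: (computable_tail (A := fun=> B)).
have argsE p : args 1 (fun=> p) = [tuple p].
  by apply: val_inj; rewrite /= enum_ordSl enum_ord0.
have smon s s' p : 0 < t s p -> s <= s' -> t s' p = t s p.
  by rewrite /t; case E: (T s _) => [//|y] _; exact: mT.
(* [w] codes a program and the first stage at which it halts. *)
pose h w := (0 < t (nsnd w) (nfst w)) &&
  ((nsnd w == 0) || (t (nsnd w).-1 (nfst w) == 0)).
have hmin w s : h w -> s < nsnd w -> t s (nfst w) = 0.
  move=> /andP[_ /orP[/eqP -> //|/eqP t0]] sw.
  apply/eqP; rewrite -leqn0 leqNgt; apply/negP => ts.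
  have /(smon _ _ _ ts) e : s <= (nsnd w).-1 by rewrite -ltnS (ltn_predK sw).
  by rewrite -e t0 in ts.
split; apply: (@Enumeration U h (fun w => word (nfst w))
  (fun w => word (t (nsnd w) (nfst w)).-1)).
- have c1 := computable_nfst (computable_var 0).
  have c2 := computable_nsnd (computable_var 0).
  by rewrite /h; comp; apply: ct; comp.
- by apply: computable_word; apply: computable_nfst; comp.
- have c1 := computable_nfst (computable_var 0).
  have c2 := computable_nsnd (computable_var 0).
  by apply: computable_word; comp; apply: ct.
- move=> w /andP[t0 _]; rewrite /run !code_word -argsE; apply: (sT (nsnd w)).
  by rewrite prednK.
- move=> p x; rewrite /run -argsE => /eT[s sP].
  have ex : exists s, 0 < t s (code p) by exists s; rewrite /t sP.
  case: (ex_minnP ex) => s0 s0P s0min.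
  exists (npair (code p) s0); rewrite /h nfst_pair nsnd_pair word_code; split=> //.
    rewrite s0P/=; case: eqP => // /eqP s00 /=.
    rewrite -leqn0 leqNgt; apply/negP => /s0min.
    by case: s0 s00 {s0P s0min} => // n _; rewrite ltnn.
  rewrite -[RHS]word_code; congr word.
  have s0s : s0 <= s by apply: s0min; rewrite /t sP.
  by rewrite -(smon _ _ _ s0P s0s) /t sP.
- move=> w w' hw hw' /(congr1 code); rewrite !code_word => e.
  rewrite -(npair_eta w) -(npair_eta w') e; congr npair.
  case: (ltngtP (nsnd w) (nsnd w')) => // lt.
    have := hmin _ _ hw' lt; rewrite -e => t0.
    by move/andP: hw => []; rewrite t0.
  have := hmin _ _ hw lt; rewrite e => t0.
  by move/andP: hw' => []; rewrite t0.
(* A program is no longer than its code, which is at most the pair [w]. This later keeps the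
   exponents in [mass] from being truncated. *)
- move=> w; apply: leq_trans (leq_nfst w); rewrite -{2}(code_word (nfst w)).
  rewrite -ltnS; have /andP[+ _] := code_size (word (nfst w)).
  by apply: leq_trans; exact: ltn_expl.
Qed.

(** * Counting programs by output length *)

(** Induction on [L], splitting the set by first bit; a set containing the empty word has no other
    element. The scale [2 ^ L] keeps the weights integral. *)
Lemma kraft L (s : seq (seq bool)) :
  uniq s -> {in s &, forall p q, prefix p q -> p = q} ->
  {in s, forall p, size p <= L} ->
  \sum_(p <- s) 2 ^ (L - size p) <= 2 ^ L.
Proof.
elim: L s => [|L IHL] s us ps sL.
  case: s us sL {ps} => [|p [|q s]]; rewrite ?big_nil ?big_seq1//= => + sL.
  have /nilP -> : size p == 0 by rewrite -leqn0 sL ?inE ?eqxx.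
  have /nilP -> : size q == 0 by rewrite -leqn0 sL ?inE ?eqxx ?orbT.
  by rewrite inE eqxx.
have [nils|nils] := boolP ([::] \in s).
  have s1 : {subset s <= [:: [::]]}.
    by move=> p sp; rewrite inE (ps [::] p nils sp)// prefix0s.
  have := uniq_leq_size us s1; case: s us s1 {ps sL nils} => [|p [|]]//= _ s1 _.
    by rewrite big_nil.
  by rewrite big_seq1 leq_exp2l// leq_subr.
(* The default of [head] is harmless, as the empty word is absent here. *)
have half b : \sum_(p <- s | head false p == b) 2 ^ (L.+1 - size p) <= 2 ^ L.
  pose sb := [seq behead p | p <- s & head false p == b].
  have consE p : p \in s -> head false p == b -> p = b :: behead p.
    by case: p => [|a p] sp /eqP /= <- //; rewrite sp in nils.
  have mem_sb p : p \in sb -> b :: p \in s.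
    move=> /mapP[q]; rewrite mem_filter => /andP[hq sq] ->.
    by rewrite -consE.
  have -> : \sum_(p <- s | head false p == b) 2 ^ (L.+1 - size p)
      = \sum_(p <- sb) 2 ^ (L - size p).
    rewrite big_map big_filter big_seq_cond [RHS]big_seq_cond.
    by apply: eq_bigr => p /andP[sp /(consE _ sp) ->].
  apply: IHL.
  - rewrite map_inj_in_uniq ?filter_uniq// => p q.
    rewrite !mem_filter => /andP[hp sp] /andP[hq sq] e.
    by rewrite (consE p)// (consE q)// e.
  - move=> p q /mem_sb sp /mem_sb sq pq; have := ps _ _ sp sq.
    by rewrite /= eqxx => /(_ pq)[].
  - by move=> p /mem_sb /sL.
rewrite (bigID (fun p => head false p == true))/= expnS mul2n -addnn.
apply: leq_add; first exact: half.
by under eq_bigl do rewrite -eqbF_neg eqb_id; exact: half.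
Qed.

Lemma sum_nat_cond_recr n (P : pred nat) (F : nat -> nat) :
  \sum_(0 <= i < n.+1 | P i) F i =
  \sum_(0 <= i < n | P i) F i + (if P n then F n else 0).
Proof. by rewrite big_mkcond big_nat_recr//= -big_mkcond. Qed.

Lemma sum_uniq_leq1 n (Q : pred nat) :
  (forall i j, Q i -> Q j -> i = j) -> \sum_(0 <= i < n | Q i) 1 <= 1.
Proof.
move=> uQ; rewrite -big_filter sum1_size.
have : uniq [seq i <- index_iota 0 n | Q i] by rewrite filter_uniq ?iota_uniq.
have := filter_all Q (index_iota 0 n).
case: [seq i <- index_iota 0 n | Q i] => [|x [|y l]]//= /and3P[Qx Qy _].
by rewrite (uQ x y)// inE eqxx.
Qed.

Lemma computable_haltsE U (E : enumeration U) A :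
  computable A -> computable (fun e => halts E (A e)).
Proof. exact/(computable_app1 (f := fun w => halts E w))/computable_halts. Qed.

Lemma computable_progE U (E : enumeration U) A :
  computable A -> computable (fun e => code (prog E (A e))).
Proof. exact/(computable_app1 (f := fun w => code (prog E w)))/computable_prog. Qed.

Lemma computable_outE U (E : enumeration U) A :
  computable A -> computable (fun e => code (out E (A e))).
Proof. exact/(computable_app1 (f := fun w => code (out E w)))/computable_out. Qed.

Ltac comp_enum :=
  lazymatch goal with
  | |- computable (fun e => size _) => apply: computable_size
  | |- computable (fun e => nat_of_bool (halts _ _)) => apply: computable_haltsE
  | |- computable (fun e => code (prog _ _)) => apply: computable_progE
  | |- computable (fun e => code (out _ _)) => apply: computable_outE
  | |- computable (fun e => code (_ ++ _)) => apply: computable_cat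
  | |- computable (fun e => code (selfdelim _)) => apply: computable_selfdelim
  | |- computable (fun e => code (bits _ _)) => apply: computable_bits
  | |- computable (fun e => code (zeros _)) => apply: computable_nseq
  | |- computable (fun e => code (nseq _ _)) => apply: computable_nseq
  | |- computable (fun e => code (word _)) => apply: computable_word
  | |- computable (fun e => nfst _) => apply: computable_nfst
  | |- computable (fun e => nsnd _) => apply: computable_nsnd
  | |- _ => fail
  end.
Ltac comp_extra ::= comp_enum.

(* [b] selects prefix-free ([true]) or plain ([false]) machines; in the plain
   case prefix-freeness is only required of programs of the same size, which is
   no condition. *)
Definition size_class (b : bool) t := if b then 0 else t.

Definition prefix_free_in_class b (M : machine) : Prop :=
  forall p q x y, run M p x -> run M q y ->
    size_class b (size p) = size_class b (size q) -> prefix p q -> p = q.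

Lemma prefix_free_in_classT M : prefix_free_in_class true M <-> prefix_free M.
Proof. by split=> pM p q x y px qy; [apply: pM px qy _ | move=> _; apply: pM px qy]. Qed.

Lemma prefix_size_eq (p q : seq bool) : size p = size q -> prefix p q -> p = q.
Proof. by rewrite prefixE => -> /eqP; rewrite take_size. Qed.

Lemma prefix_free_in_classF M : prefix_free_in_class false M.
Proof. by move=> p q x y _ _; exact: prefix_size_eq. Qed.

(** * Ranks of programs and short descriptions of lengths *)

Section counting.
Variables (U : machine) (E : enumeration U) (b : bool).
Hypothesis pfU : prefix_free_in_class b U.

Local Notation sz w := (size (prog E w)).

Definition sibling w v := [&& halts E v, sz v == sz w & size (out E v) == size (out E w)].

Definition rank w := \sum_(0 <= v < w | sibling w v) 1.

(* [w] lists the [2 ^ (3 * d)]-th program of its size and output length. *)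
Definition event d w := halts E w && ((rank w).+1 == 2 ^ (3 * d)).

Lemma computable_rank A : computable A -> computable (fun e => rank (A e)).
Proof.
move=> cA; apply: (@computable_app1 rank) => //.
apply: (computable_sum_cond (P := fun v e => sibling (e 0) v) (F := fun _ _ => 1));
  rewrite /sibling; by comp.
Qed.

Lemma computable_event A D : computable A -> computable D ->
  computable (fun e => event (D e) (A e)).
Proof. by move=> cA cD; rewrite /event; comp; exact: computable_rank. Qed.

Lemma rank_lt w v : sibling w v -> v < w -> rank v < rank w.
Proof.
move=> wv vw; rewrite /rank [ltnRHS](big_cat_nat_idem _ (n := v.+1))//=.
rewrite sum_nat_cond_recr wv.
rewrite (eq_bigl (sibling w)); first by lia.
by move=> u; move: wv; rewrite /sibling => /and3P[_ /eqP -> /eqP ->].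
Qed.

(** The number of siblings listed below [k] grows by at most one as [k] does, so no value is
    skipped. *)
Lemma rank_surj w n : n < rank w -> exists2 v, sibling w v & rank v = n.
Proof.
move=> nw; pose g k := \sum_(0 <= v < k | sibling w v) 1.
have ex : exists k, n < g k by exists w.
case: (ex_minnP ex) => -[|k]; first by rewrite /g big_geq.
move=> nk kmin; have gk : g k <= n.
  by rewrite leqNgt; apply/negP => /kmin; rewrite ltnn.
have gS : g k.+1 = g k + sibling w k.
  by rewrite /g sum_nat_cond_recr; case: sibling.
have wk : sibling w k by move: nk gk; rewrite gS; case: sibling => //; lia.
exists k => //; rewrite gS wk in nk.
have -> : rank k = g k.
  apply: eq_bigl => u.
  by move: wk; rewrite /sibling => /and3P[_ /eqP -> /eqP ->].
lia.
Qed.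

(* The total weight, scaled by [2 ^ B], of the events before [w], an event for
   programs of size [t] having weight [2 ^ (3 * d - t)]. *)
Definition mass d c B w :=
  \sum_(0 <= v < w | event d v && (size_class b (sz v) == c))
    2 ^ (B + 3 * d - sz v).

(** An event at [v] weighs as much as the [2 ^ (3 * d)] siblings of [v] listed up to [v]. No program
    is counted for two events, since these would be siblings of equal rank, so Kraft's inequality
    within the class bounds the total. *)
Lemma mass_le d c B w : w <= B -> mass d c B w <= 2 ^ B.
Proof.
move=> wB; pose ev v := event d v && (size_class b (sz v) == c).
pose hc u := halts E u && (size_class b (sz u) == c).
have evE v : v < w -> ev v -> 2 ^ (B + 3 * d - sz v) =
    \sum_(0 <= u < w | (u <= v) && sibling v u) 2 ^ (B - sz u).
  move=> vw /andP[/andP[hv /eqP dv] _].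
  have svB : sz v <= B by have := size_prog E v; lia.
  rewrite (eq_bigr (fun=> 2 ^ (B - sz v) * 1)) => [|u]; last first.
    by rewrite muln1 => /andP[_ /and3P[_ /eqP -> _]].
  rewrite -big_distrr/= -addnBAC// expnD -dv; congr (_ * _).
  rewrite (big_cat_nat_idem _ (n := v.+1))//=.
  rewrite [X in _ + X]big_nat_cond [X in _ + X]big1 ?addn0.
    rewrite sum_nat_cond_recr leqnn /sibling hv !eqxx/= addn1.
    congr S; rewrite /rank [RHS]big_nat_cond [LHS]big_nat_cond; apply: eq_bigl => u.
    by case: (ltnP u v) => //= uv; rewrite (ltnW uv).
  by move=> u /andP[/andP[vu _] /andP[uv _]]; lia.
apply: leq_trans (_ : \sum_(0 <= u < w | hc u) 2 ^ (B - sz u) <= _).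
  rewrite /mass big_nat_cond.
  rewrite (eq_bigr (fun v => \sum_(0 <= u < w | (u <= v) && sibling v u) 2 ^ (B - sz u)));
    last by move=> v /andP[/andP[_ vw] evv]; exact: evE.
  rewrite -big_nat_cond (exchange_big_dep_nat hc)/=; last first.
    by move=> v u _ _ /andP[_ /eqP vc] /andP[_ /and3P[hu /eqP vu _]];
      rewrite /hc hu vu vc eqxx.
  apply: leq_sum => u _; rewrite -[X in _ <= X]muln1.
  rewrite (eq_bigr (fun=> 2 ^ (B - sz u) * 1)) => [|v]; last by rewrite muln1.
  rewrite -big_distrr leq_mul2l; apply/orP; right; apply: sum_uniq_leq1.
  have lt_absurd v v' : v < v' -> ev v -> ev v' -> sibling v u -> sibling v' u -> False.
    move=> vv /andP[/andP[hv /eqP rv] _] /andP[/andP[_ /eqP rv'] _].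
    move=> /and3P[_ /eqP uv /eqP ouv] /and3P[_ /eqP uv' /eqP ouv'].
    have /rank_lt/(_ vv) : sibling v' v.
      by rewrite /sibling hv -uv -uv' -ouv -ouv' !eqxx.
    by rewrite -ltnS rv rv' ltnn.
  move=> v v' /andP[ev_v /andP[_ vu]] /andP[ev_v' /andP[_ vu']].
  case: (ltngtP v v') => // [vv|vv]; exfalso; exact: lt_absurd vv _ _ _ _.
rewrite -big_filter -(big_map (prog E) predT (fun p => 2 ^ (B - size p))).
have mem_hc u : u \in [seq u <- index_iota 0 w | hc u] -> [/\ halts E u,
    size_class b (sz u) = c & u < w].
  by rewrite mem_filter mem_index_iota => /andP[/andP[? /eqP ?] ?].
apply: kraft.
- rewrite map_inj_in_uniq ?filter_uniq ?iota_uniq// => u v /mem_hc[hu _ _].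
  by move=> /mem_hc[hv _ _]; exact: prog_inj.
- move=> p q /mapP[u /mem_hc[hu cu _] ->] /mapP[v /mem_hc[hv cv _] ->].
  by apply: (pfU (run_halts hu) (run_halts hv)); rewrite cu cv.
- move=> p /mapP[u /mem_hc[_ _ uw] ->].
  exact: leq_trans (size_prog E u) (leq_trans (ltnW uw) wB).
Qed.

(** By [mass_le] the weight of a single event is at most [1]. Hence the subtraction in [excess] is
    not truncated at an event. *)
Lemma event_size d w : event d w -> 3 * d <= sz w.
Proof.
move=> dw; have := mass_le d (size_class b (sz w)) (leqnn w.+1).
rewrite /mass sum_nat_cond_recr dw eqxx/=.
move=> /(leq_trans (leq_addl _ _)); rewrite leq_exp2l//.
by have := size_prog E w; lia.
Qed.

Definition excess d w := sz w - 3 * d.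

(* Shannon-Fano-Elias coding: the dyadic interval with index [position d w] and
   length [2 ^ - (excess d w).+1] lies inside the interval of length
   [2 ^ - (excess d w)] starting at the mass of the previous events. *)
Definition position d w :=
  (mass d (size_class b (sz w)) w.+1 w %/ 2 ^ (w - excess d w)).+1.

Definition codeword d w := bits (excess d w).+1 (position d w).

(** The common scale [B] makes different events comparable. An event is two grid units long, and
    rounding its start up to the grid moves it by at most one unit, so one whole grid interval fits
    inside. *)
Lemma position_bounds d w B : event d w -> w < B ->
  mass d (size_class b (sz w)) B w < position d w * 2 ^ (B.-1 - excess d w) /\
  (position d w).+1 * 2 ^ (B.-1 - excess d w)
    <= mass d (size_class b (sz w)) B w.+1.
Proof.
move=> dw wB; set c := size_class b (sz w).
have sw := size_prog E w; have ds := event_size dw.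
have ew : excess d w <= w by rewrite /excess; lia.
(* [position] is computed at scale [w.+1]; passing to [B] multiplies every weight by the same power
   of two. *)
have massE : mass d c B w = 2 ^ (B.-1 - w) * mass d c w.+1 w.
  rewrite /mass big_distrr/= big_nat_cond [RHS]big_nat_cond.
  apply: eq_bigr => v /andP[/andP[_ vw] _]; rewrite -expnD; congr expn.
  by have := size_prog E v; lia.
have massS : mass d c B w.+1 = mass d c B w + 2 ^ (B - excess d w).
  rewrite /mass sum_nat_cond_recr dw eqxx/=.
  by congr (_ + 2 ^ _); rewrite /excess; lia.
have -> : 2 ^ (B.-1 - excess d w) = 2 ^ (B.-1 - w) * 2 ^ (w - excess d w).
  by rewrite -expnD; congr expn; lia.
rewrite massS massE mulnCA; split.
  by rewrite ltn_pmul2l ?expn_gt0// /position ltn_ceil ?expn_gt0.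
have -> : 2 ^ (B - excess d w) = 2 ^ (B.-1 - w) * (2 * 2 ^ (w - excess d w)).
  by rewrite -expnS -expnD; congr expn; lia.
rewrite -mulnDr mulnCA leq_pmul2l ?expn_gt0//.
rewrite /position -/c; set k := 2 ^ _; set m := mass _ _ _ _.
by have := leq_trunc_div m k; lia.
Qed.

Lemma position_lt d w : event d w -> position d w < 2 ^ (excess d w).+1.
Proof.
move=> dw; have [_ le] := position_bounds dw (ltnSn w).
have := leq_trans le (mass_le d _ (leqnn w.+1)).
have -> : 2 ^ w.+1 = 2 ^ (excess d w).+1 * 2 ^ (w - excess d w).
  by rewrite -expnD; congr expn; have := size_prog E w; rewrite /excess; lia.
by rewrite leq_pmul2r ?expn_gt0.
Qed.

(** A prefix would nest the two dyadic intervals, but distinct events of one class occupy disjoint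
    successive increments of [mass]. *)
Lemma codeword_prefix d w v : event d w -> event d v ->
  size_class b (sz w) = size_class b (sz v) ->
  prefix (codeword d w) (codeword d v) -> w = v.
Proof.
move=> dw dv wv /(bits_prefix (position_lt dw) (position_lt dv))[rwv pE].
pose B := (maxn w v).+1.
have lE : 2 ^ (B.-1 - excess d w) =
    2 ^ ((excess d v).+1 - (excess d w).+1) * 2 ^ (B.-1 - excess d v).
  have : excess d v <= B.-1.
    exact: leq_trans (leq_subr _ _) (leq_trans (size_prog E v) (leq_maxr _ _)).
  by rewrite -expnD; move: rwv; clear; move=> ? ?; congr expn; lia.
have [lo_w hi_w] := position_bounds dw (leq_maxl w v : w < B).
have [lo_v hi_v] := position_bounds dv (leq_maxr w v : v < B).
have mono x y : x <= y -> mass d (size_class b (sz w)) B x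
    <= mass d (size_class b (sz w)) B y.
  by move=> xy; rewrite /mass [leqRHS](big_cat_nat_idem _ (n := x))//= leq_addr.
rewrite -wv in lo_v hi_v.
have := leq_trunc_div (position d v) (2 ^ ((excess d v).+1 - (excess d w).+1)).
have := ltn_ceil (position d v) (_ : 0 < 2 ^ ((excess d v).+1 - (excess d w).+1)).
rewrite -pE expn_gt0 => /(_ isT).
move: lo_w hi_w lo_v hi_v; rewrite lE.
set k := 2 ^ (_.+1 - _); set l := 2 ^ _.
have l0 : 0 < l by rewrite expn_gt0.
move=> lo_w hi_w lo_v hi_v lt_v le_v.
case: (ltngtP w v) => // /mono lt; exfalso.
  have := leq_mul lt_v (leqnn l); rewrite -mulnA.
  move=> /leq_trans/(_ hi_w)/leq_trans/(_ lt)/leq_ltn_trans/(_ lo_v).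
  by rewrite ltn_pmul2r// ltnNge leqnSn.
have := leq_mul le_v (leqnn l); rewrite -mulnA.
move=> /(leq_trans lo_w)/(leq_ltn_trans lt)/(leq_ltn_trans hi_v).
by rewrite ltn_pmul2r// ltnNge leqnSn.
Qed.

(** [P w p] says that [p] is a program for the index [w], which the machine searches for. The last
    hypothesis yields uniqueness of [w] (case [p = q]) as well as prefix-freeness in each class. *)
Lemma machine_of_prefix_search (P : nat -> seq bool -> bool) (F : nat -> seq bool) :
  computable (fun e => P (e 0) (word (e 1))) ->
  computable (fun e => code (F (e 0))) ->
  (forall w w' p q, P w p -> P w' q ->
    size_class b (size p) = size_class b (size q) -> prefix p q ->
    p = q /\ w = w') ->
  exists2 M, prefix_free_in_class b M & forall w p, P w p -> run M p (F w).
Proof.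
move=> cP cF uP.
have [|M MP] := search_machine (P := fun w n => P w (word n))
  (F := fun w => code (F w)) cP cF.
  by move=> w w' q /uP + /[dup] => /[apply]/(_ erefl (prefix_refl _))[].
have runM p x : run M p x <-> exists2 w, P w p & x = F w.
  rewrite /run MP; split=> -[w]; rewrite word_code => wp.
    by move=> /code_inj ->; exists w.
  by move=> ->; exists w; rewrite ?word_code.
exists M => [p q x y|w p wp]; last by apply/runM; exists w.
by move=> /runM[w wp _] /runM[w' wq _] pq /(uP _ _ _ _ wp wq pq)[].
Qed.

Lemma zeros_machine : exists2 M, prefix_free_in_class b M &
  forall d w, event d w ->
    run M (selfdelim d ++ codeword d w) (zeros (size (out E w))).
Proof.
pose P a q := event (nsnd a) (nfst a) &&
  (code q == code (selfdelim (nsnd a) ++ codeword (nsnd a) (nfst a))).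
have [|||M pM MP] := @machine_of_prefix_search P
    (fun a => zeros (size (out E (nfst a)))).
- have c1 := computable_nfst (computable_var 0).
  have c2 := computable_nsnd (computable_var 0).
  rewrite /P /codeword /position /excess; comp.
  + exact: computable_event.
  + rewrite /mass; apply: (computable_sum_cond
      (P := fun v e => event (nsnd (e 0)) v &&
        (size_class b (sz v) == size_class b (sz (nfst (e 0)))))
      (F := fun v e => 2 ^ ((nfst (e 0)).+1 + 3 * nsnd (e 0) - sz v))).
    * by comp.
    * by rewrite /size_class; case: (b); comp; apply: computable_event; comp.
    * by comp.
- by comp.
- move=> a a' p q /andP[ev /eqP/code_inj ->] /andP[ev' /eqP/code_inj ->].
  move=> cl /[dup] pre /selfdelim_prefix[dd pre'].
  suff aa : nfst a = nfst a'.
    have -> : a = a' by rewrite -(npair_eta a) -(npair_eta a') aa dd.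
    by [].
  (* In the plain case, equal total sizes and equal [d] give equal [excess], hence equal program
     sizes because nothing was truncated. *)
  rewrite -dd in ev' pre' cl; have := event_size ev; have := event_size ev'.
  move=> le' le; apply: codeword_prefix ev ev' _ pre'.
  move: cl; rewrite /size_class; case: (b) => //.
  rewrite !size_cat !size_bits /excess => /addnI[].
  by lia.
exists M => // d w ev; have := MP (npair w d); rewrite nfst_pair; apply.
by rewrite /P nfst_pair nsnd_pair ev eqxx.
Qed.

Lemma size_word n : 2 ^ size (word n) <= n.+1.
Proof. by have /andP[] := code_size (word n); rewrite code_word. Qed.

(** Such a rank forces an event at some sibling. Its description spends at most [2 * d + 1] bits on
    [d] and [sz w - 3 * d + 1] on the codeword, which saves [d] up to a constant. *)
Lemma rank_bound (N : machine) : optimal_in (prefix_free_in_class b) N ->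
  exists c, forall w d, halts E w -> 2 ^ (3 * d) <= rank w ->
    exists2 q, run N q (zeros (size (out E w))) & size q + d <= sz w + c.
Proof.
move=> [_ optN]; have [M /optN[c cP] MP] := zeros_machine.
exists c.+2 => w d hw; rewrite -[X in X <= _]prednK ?expn_gt0//.
move=> /rank_surj[v /and3P[hv /eqP vw /eqP ovw] rv].
have ev : event d v by rewrite /event hv rv prednK ?expn_gt0 ?eqxx.
have [q [qz qs]] := cP _ _ (MP _ _ ev).
rewrite ovw in qz; exists q => //.
have sd : size (word d) <= d.
  by rewrite -ltnS; apply: leq_trans (size_word d); exact: ltn_expl.
move: qs; rewrite size_cat size_selfdelim size_bits /excess vw.
by have := event_size ev; rewrite vw; lia.
Qed.
End counting.

(** * The complexity of an interleaved string *)

Definition join n (x y : seq bool) : seq bool :=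
  mkseq (fun i => if odd i then nth false y i./2 else nth false x i./2) n.

Lemma computable_join N X Y : computable N ->
  computable (fun e => code (X e)) -> computable (fun e => code (Y e)) ->
  computable (fun e => code (join (N e) (X e) (Y e))).
Proof.
move=> cN cX cY.
have : computable (fun e => code (join (e 0) (word (e 1)) (word (e 2)))).
  apply: (computable_mkseq (P := fun i e =>
    if odd i then nth false (word (e 2)) i./2 else nth false (word (e 1)) i./2));
    first by comp.
  have -> : (fun e => (if odd (e 0) then nth false (word (e 3)) (e 0)./2
      else nth false (word (e 2)) (e 0)./2) : nat) =
    (fun e => if odd (e 0) then nth false (word (e 3)) (e 0)./2 : nat
      else nth false (word (e 2)) (e 0)./2).
    by apply: funext => e; case: odd.
  by comp; apply: computable_nth; comp.
move=> /(computable_app3 (f := fun n x y => code (join n (word x) (word y)))).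
move=> /(_ N (fun e => code (X e)) (fun e => code (Y e)) cN cX cY).
by under eq_fun do rewrite !word_code.
Qed.

(** The complexity function with values in [nat], the minimum being attained; [complexity_shortest]
    links it to [complexity]. *)
Definition shortest (U : machine) (k : seq bool -> nat) : Prop :=
  forall x, (exists2 p, run U p x & size p = k x) /\
    forall p, run U p x -> k x <= size p.

Section upper_bound.
Variables (b : bool) (U : machine) (k : seq bool -> nat).
Hypothesis optU : optimal_in (prefix_free_in_class b) U.
Hypothesis kU : shortest U k.

(** The machine keeps the programs of [U] and only replaces an output of length [n] by
    [zeros (g n)], so prefix-freeness is inherited. *)
Lemma shortest_zeros (g : nat -> nat) : computable (fun e => g (e 0)) ->
  exists c, forall n, k (zeros (g n)) <= k (zeros n) + c.
Proof.
move=> cg; have [pU opt] := optU; have [E] := enumerate U.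
have [|||M pM MP] := @machine_of_prefix_search b
    (fun w q => halts E w && (code q == code (prog E w)))
    (fun w => zeros (g (size (out E w)))).
- by comp.
- by comp; apply: (computable_app1 cg); comp.
- move=> w w' p q /andP[hw /eqP/code_inj ->] /andP[hw' /eqP/code_inj ->].
  move=> cl /(pU _ _ _ _ (run_halts hw) (run_halts hw') cl) pp.
  by split=> //; exact: prog_inj pp.
have [c cP] := opt _ pM; exists c => n.
have [[p pn <-] _] := kU (zeros n).
have [w [hw wp wn]] := run_enum E pn.
have := MP w (prog E w); rewrite hw eqxx => /(_ isT)/cP[q [qz qs]].
have [_ /(_ q)] := kU (zeros (g n)).
rewrite wn wp size_nseq in qz qs; move=> /(_ qz) /leq_trans; exact.
Qed.

Lemma shortest_halves : exists c, forall n h, h = uphalf n \/ h = n./2 ->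
  k (zeros h) <= k (zeros n) + c /\ k (zeros n) <= k (zeros h) + c.
Proof.
have [| c1 P1] := @shortest_zeros uphalf; first by comp.
have [| c2 P2] := @shortest_zeros half; first by comp.
have [| c3 P3] := @shortest_zeros double; first by comp.
have [| c4 P4] := @shortest_zeros (fun n => n.*2.+1); first by comp.
have [| c5 P5] := @shortest_zeros (fun n => n.*2.-1); first by comp.
exists (c1 + c2 + c3 + c4 + c5) => n h hn; split.
  by case: hn => ->; [have := P1 n|have := P2 n]; lia.
(* Rounding leaves three candidates for [n], each a computable function of [h]. *)
have : n = h.*2 \/ n = h.*2.+1 \/ n = h.*2.-1.
  by case: hn => ->; have := odd_double_half n; rewrite ?uphalf_half;
    case: odd => /=; lia.
by move=> [|[|]] {1}->; [have := P3 h|have := P4 h|have := P5 h]; lia.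
Qed.

(** * Decoding a joined string from a length and two ranks *)

Section decoder.
Variables (E : enumeration U) (c : nat).
Local Notation sz w := (size (prog E w)).

Lemma rank_inj w v : halts E w -> halts E v -> sz w = sz v ->
  size (out E w) = size (out E v) -> rank E w = rank E v -> w = v.
Proof.
move=> hw hv wv ovw r; case: (ltngtP w v) => // lt.
  have /rank_lt/(_ lt) : sibling E v w by rewrite /sibling hw wv ovw !eqxx.
  by rewrite r ltnn.
have /rank_lt/(_ lt) : sibling E w v by rewrite /sibling hv wv ovw !eqxx.
by rewrite r ltnn.
Qed.

(* The shift by [c] keeps the difference of the two sizes nonnegative. *)
Definition part w0 w := selfdelim (sz w + c - sz w0) ++ selfdelim (rank E w).

(** The self-delimiting parts come first, so that what remains is a program of [U] and its
    prefix-freeness can be used. *)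
Definition description w0 w1 w2 := part w0 w1 ++ part w0 w2 ++ prog E w0.

Definition decodable w0 h w :=
  [&& halts E w, size (out E w) == h & sz w0 <= sz w + c].

Definition decodable3 w0 w1 w2 := [&& halts E w0,
  decodable w0 (uphalf (size (out E w0))) w1 &
  decodable w0 (size (out E w0))./2 w2].

Lemma part_prefix w0 w v0 v x y :
  prefix (part w0 w ++ x) (part v0 v ++ y) ->
  [/\ sz w + c - sz w0 = sz v + c - sz v0, rank E w = rank E v & prefix x y].
Proof.
rewrite /part -(catA (selfdelim (sz w + c - sz w0)))
  -(catA (selfdelim (sz v + c - sz v0))).
by move=> /selfdelim_prefix[-> /selfdelim_prefix[-> ->]].
Qed.

(** Once the parts are stripped, [U] determines [w0], hence the length and [sz w0]. Each part then
    supplies a program size and a rank, which with the output length fix the program by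
    [rank_inj]. *)
Lemma decoder : exists2 M, prefix_free_in_class b M &
  forall w0 w1 w2, decodable3 w0 w1 w2 ->
    run M (description w0 w1 w2)
      (join (size (out E w0)) (out E w1) (out E w2)).
Proof.
pose P a q := decodable3 (nfst a) (nfst (nsnd a)) (nsnd (nsnd a)) &&
  (code q == code (description (nfst a) (nfst (nsnd a)) (nsnd (nsnd a)))).
pose F a := join (size (out E (nfst a))) (out E (nfst (nsnd a)))
  (out E (nsnd (nsnd a))).
have [|||M pM MP] := @machine_of_prefix_search b P F.
- rewrite /P /decodable3 /decodable /description /part; comp;
    by apply: computable_rank; comp.
- by apply: computable_join; comp.
- move=> a a' p q /andP[da /eqP/code_inj ->] /andP[da' /eqP/code_inj ->].
  suff aa : size_class b (size (description (nfst a) (nfst (nsnd a)) (nsnd (nsnd a))))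
    = size_class b (size (description (nfst a') (nfst (nsnd a')) (nsnd (nsnd a')))) ->
    prefix (description (nfst a) (nfst (nsnd a)) (nsnd (nsnd a)))
      (description (nfst a') (nfst (nsnd a')) (nsnd (nsnd a'))) ->
    [/\ nfst a = nfst a', nfst (nsnd a) = nfst (nsnd a') &
      nsnd (nsnd a) = nsnd (nsnd a')].
    move=> cl /(aa cl)[e0 e1 e2]; suff -> : a = a' by [].
    rewrite -(npair_eta a) -(npair_eta a') e0.
    by rewrite -(npair_eta (nsnd a)) -(npair_eta (nsnd a')) e1 e2.
  move: da da'; rewrite /decodable3 /decodable.
  move: (nfst a) (nfst (nsnd a)) (nsnd (nsnd a)) => w0 w1 w2.
  move: (nfst a') (nfst (nsnd a')) (nsnd (nsnd a')) => v0 v1 v2.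
  move=> /and3P[hw0 /and3P[hw1 /eqP ow1 sw1] /and3P[hw2 /eqP ow2 sw2]].
  move=> /and3P[hv0 /and3P[hv1 /eqP ov1 sv1] /and3P[hv2 /eqP ov2 sv2]].
  move=> cl /part_prefix[e1 r1 /part_prefix[e2 r2 pre]].
  have [pU _] := optU.
  (* In the plain case, equal total sizes with equal parts leave equal sizes for the programs of the
     length. *)
  have cl0 : size_class b (sz w0) = size_class b (sz v0).
    move: cl; rewrite /description /part e1 r1 e2 r2 /size_class.
    by case: (b) => //; rewrite !size_cat; lia.
  have := pU _ _ _ _ (run_halts hw0) (run_halts hv0) cl0 pre.
  move=> /(prog_inj hw0 hv0) wv0; subst v0.
  (* The bounds [sz w0 <= sz w + c] make the subtraction in [part] exact, so equal differences give
     equal sizes. *)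
  split=> //; [apply: rank_inj r1 | apply: rank_inj r2] => //; first by lia.
  - by rewrite ow1 ov1.
  - by lia.
  - by rewrite ow2 ov2.
exists M => // w0 w1 w2 dec.
have := MP (npair w0 (npair w1 w2)); rewrite /F !(nfst_pair, nsnd_pair); apply.
by rewrite /P !(nfst_pair, nsnd_pair) dec eqxx.
Qed.

End decoder.

Hypothesis normalized : forall x, k (zeros (size x)) <= k x.

(** The factor [8] is [2 + 6]: [selfdelim] doubles lengths, the size difference takes at most
    [k x - k (zeros h)] bits and the rank three times as many, up to constants. *)
Lemma shortest_join : exists c, forall n x y,
  size x = uphalf n -> size y = n./2 ->
  k (join n x y) <= k (zeros n) + 8 * (k x - k (zeros (uphalf n)))
    + 8 * (k y - k (zeros n./2)) + c.
Proof.
have [E] := enumerate U; have [pU opt] := optU.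
have [c1 halves] := shortest_halves.
have [c2 rb] := rank_bound E pU optU.
have [M /opt[c3 MP] decM] := decoder E c1.
have enum x : exists w, [/\ halts E w, out E w = x & size (prog E w) = k x].
  have [[p px <-] _] := kU x; have [w [hw wp wx]] := run_enum E px.
  by exists w; rewrite wp.
have part_size w0 w n x h : size (prog E w0) = k (zeros n) ->
    halts E w -> out E w = x -> size (prog E w) = k x -> size x = h ->
    h = uphalf n \/ h = n./2 ->
    size (prog E w0) <= size (prog E w) + c1 /\
    size (part E c1 w0 w) <= 8 * (k x - k (zeros h)) + (4 * c1 + 6 * c2 + 8).
  move=> s0 hw ow sw xh hn; have [le1 le2] := halves n h hn.
  have nx := normalized x; rewrite xh in nx.
  split; first by lia.
  rewrite /part size_cat !size_selfdelim sw s0.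
  set e := k x + c1 - _.
  have se : size (word e) <= e.
    by rewrite -ltnS; apply: leq_trans (size_word e); exact: ltn_expl.
  (* The extra one in [c2.+1] makes the program supplied by [rank_bound] shorter than [k (zeros h)],
     a contradiction. *)
  pose d := k x - k (zeros h) + c2.+1.
  have rd : rank E w < 2 ^ (3 * d).
    rewrite ltnNge; apply/negP => /(rb _ _ hw)[q]; rewrite ow xh sw => qz.
    have [_ /(_ q qz)] := kU (zeros h).
    by rewrite /d; lia.
  have sr : size (word (rank E w)) <= 3 * d.
    rewrite -(@leq_exp2l 2)//; exact: leq_trans (size_word _) rd.
  by move: se sr; rewrite /e /d; lia.
exists (2 * (4 * c1 + 6 * c2 + 8) + c3) => n x y xn yn.
have [w0 [h0 o0 s0]] := enum (zeros n).
have [w1 [h1 o1 s1]] := enum x; have [w2 [h2 o2 s2]] := enum y.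
have on : size (out E w0) = n by rewrite o0 size_nseq.
have [le1 ps1] := part_size w0 w1 n x _ s0 h1 o1 s1 xn (or_introl erefl).
have [le2 ps2] := part_size w0 w2 n y _ s0 h2 o2 s2 yn (or_intror erefl).
have /decM/MP[q] : decodable3 E c1 w0 w1 w2.
  by rewrite /decodable3 /decodable h0 h1 h2 le1 le2 o1 o2 on xn yn !eqxx.
rewrite on o1 o2 => -[qj qs]; have [_ /(_ q qj)] := kU (join n x y).
move: qs; rewrite /description size_cat (size_cat (part E c1 w0 w2)) s0; lia.
Qed.

End upper_bound.

(** A machine reading self-delimiting codes outputs every string, so by optimality [U] has a program
    for each. *)
Lemma shortest_exists b U : optimal_in (prefix_free_in_class b) U ->
  exists k, shortest U k.
Proof.
move=> [pU opt].
have [|||M pM MP] := @machine_of_prefix_search b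
    (fun w q => code q == code (selfdelim w)) word.
- by comp.
- by comp.
- move=> w w' p q /eqP/code_inj -> /eqP/code_inj -> _.
  by rewrite -[selfdelim w]cats0 -[selfdelim w']cats0 => /selfdelim_prefix[->].
have [c cP] := opt _ pM.
have /choice[k kP] : forall x, exists n, (exists2 p, run U p x & size p = n) /\
    forall p, run U p x -> n <= size p; last by exists k.
move=> x; pose hp n := `[< exists2 p, run U p x & size p = n >].
have ex : exists n, hp n.
  have [q [qx _]] := cP _ _ (MP (code x) _ (eqxx _)).
  by exists (size q); apply/asboolP; exists q; rewrite // -[x]word_code.
case: (ex_minnP ex) => n /asboolP hn nmin; exists n; split=> // p px.
by apply: nmin; apply/asboolP; exists p.
Qed.

(** * Mean complexity of the product measure *)

Import Order.TTheory GRing.Theory Num.Theory.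
Local Open Scope classical_set_scope.
Local Open Scope ring_scope.

Lemma complexity_shortest (R : realType) U k x :
  shortest U k -> complexity R U x = (k x)%:R%:E.
Proof.
move=> /(_ x)[[p px kp] kmin]; apply/eqP; rewrite eq_le; apply/andP; split.
  by apply: ereal_inf_lbound; exists p => //=; rewrite kp.
apply: le_ereal_inf_tmp => _ [q qx <-].
by rewrite lee_fin ler_nat; exact: kmin.
Qed.

Definition join_tuple n (u : (uphalf n).-tuple bool * (n./2).-tuple bool) :
    n.-tuple bool :=
  @Tuple n bool (join n u.1 u.2) (introT eqP (size_mkseq _ n)).

Lemma join_tuple_bij n : bijective (@join_tuple n).
Proof.
(* As [uphalf n + n./2 = n], both sides have [2 ^ n] elements; the even and odd positions give
   injectivity. *)
apply: inj_card_bij; last first.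
  rewrite card_prod !card_tuple card_bool -expnD leq_exp2l// uphalf_half.
  by have := odd_double_half n; lia.
move=> [x y] [x' y'] /(congr1 val); rewrite /= => e.
have nthE i : (i < n)%N -> (if odd i then nth false y i./2 else nth false x i./2)
    = (if odd i then nth false y' i./2 else nth false x' i./2).
  move=> ilt; have := congr1 (fun s => nth false s i) e.
  by rewrite /join !nth_mkseq.
congr pair; apply: val_inj; apply: (@eq_from_nth _ false); rewrite !size_tuple// => i ilt.
  have := nthE i.*2; rewrite odd_double doubleK; apply.
  by move: ilt; rewrite uphalf_half; have := odd_double_half n; lia.
have := nthE i.*2.+1; rewrite /= odd_double uphalf_double; apply.
by have := odd_double_half n; lia.
Qed.

Lemma mem_cylinder x (Z : cantor) :
  cylinder x Z <-> mkseq Z (size x) = x.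
Proof.
split=> [Zx|e i ilt]; last first.
  by have := congr1 (fun s => nth false s i) e; rewrite nth_mkseq.
apply: (@eq_from_nth _ false); rewrite size_mkseq// => i ilt.
by rewrite nth_mkseq// Zx.
Qed.

Lemma sum_cylinder (R : realType) (mu : probability cantor R) m :
  (\sum_(x : m.-tuple bool) mu (cylinder x))%E = 1%E.
Proof.
rewrite -big_enum/= fsbig_seq ?enum_uniq// -measure_fin_bigcup.
- rewrite -[RHS](probability_setT mu); congr (mu _).
  apply/seteqP; split=> // Z _.
  pose z := @Tuple m bool (mkseq Z m) (introT eqP (size_mkseq _ m)).
  exists z; first by rewrite /= mem_enum.
  by apply/mem_cylinder; rewrite size_tuple.
- exact: finite_seq.
- move=> x y _ _ [Z [/mem_cylinder Zx /mem_cylinder Zy]].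
  by apply: val_inj; rewrite /= -Zx -Zy !size_tuple.
- by move=> x _; exact: measurable_cylinder.
Qed.

Lemma preimage_interleave_cylinder n (u : (uphalf n).-tuple bool * (n./2).-tuple bool) :
  interleave @^-1` cylinder (join_tuple u) = cylinder u.1 `*` cylinder u.2.
Proof.
apply/seteqP; split=> [[A B]|[A B] [/= Au Bu]] /=.
- rewrite /cylinder /= size_mkseq => h; split=> i; rewrite size_tuple => ilt.
  + have /h : (i.*2 < n)%N.
      by move: ilt; have := odd_double_half n; rewrite uphalf_half; lia.
    rewrite /interleave /= nth_mkseq ?odd_double ?doubleK//.
    by move: ilt; have := odd_double_half n; rewrite uphalf_half; lia.
  + have lt : (i.*2.+1 < n)%N by move: ilt; have := odd_double_half n; lia.
    by have := h _ lt; rewrite /interleave nth_mkseq //= odd_double/= uphalf_double.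
- move=> i; rewrite size_tuple => ilt; rewrite nth_mkseq// /interleave /=.
  case: ifP => oi; [apply: Bu | apply: Au]; rewrite size_tuple.
    by move: ilt; have := odd_double_half n; have := odd_double_half i; rewrite oi; lia.
  move: ilt; have := odd_double_half n; have := odd_double_half i.
  by rewrite oi uphalf_half; lia.
Qed.

Lemma product_probability_cylinder (R : realType) (mu nu : probability cantor R)
    n (u : (uphalf n).-tuple bool * (n./2).-tuple bool) :
  product_probability mu nu (cylinder (join_tuple u)) =
  (mu (cylinder u.1) * nu (cylinder u.2))%E.
Proof.
rewrite /product_probability /distribution /pushforward /=.
rewrite preimage_interleave_cylinder product_measure1E//;
  exact: measurable_cylinder.
Qed.

Lemma mean_complexity_shortest (R : realType) U k (mu : probability cantor R) n :
  shortest U k -> mean_complexity U mu n =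
    (\sum_(x : n.-tuple bool) (k x)%:R * fine (mu (cylinder x)))%:E.
Proof.
move=> kU; rewrite -sumEFin; apply: eq_bigr => x _.
rewrite (complexity_shortest R x kU) EFinM fineK//.
exact: fin_num_measure (measurable_cylinder x).
Qed.

Lemma sum_fine_cylinder (R : realType) (mu : probability cantor R) m :
  \sum_(x : m.-tuple bool) fine (mu (cylinder x)) = 1.
Proof.
apply: EFin_inj; rewrite -sumEFin -[RHS](sum_cylinder mu m).
apply: eq_bigr => x _; rewrite fineK//.
exact: fin_num_measure (measurable_cylinder x).
Qed.

(** The integrand is affine in [f i] and [g j] separately, so with total masses one its mean
    involves only the two marginal means. *)
Lemma weighted_excess (R : realFieldType) (I J : finType) (a : I -> R) (b : J -> R)
    (f : I -> R) (g : J -> R) (s t p q r : R) :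
  \sum_i a i = 1 -> \sum_j b j = 1 ->
  \sum_i f i * a i <= p + s -> \sum_j g j * b j <= q + t ->
  \sum_i \sum_j (r + 8%:R * (f i - p) + 8%:R * (g j - q)) * (a i * b j)
    <= r + 8%:R * s + 8%:R * t.
Proof.
move=> a1 b1 fs gt.
have -> : \sum_i \sum_j (r + 8%:R * (f i - p) + 8%:R * (g j - q)) * (a i * b j)
    = (r - 8%:R * p - 8%:R * q) * ((\sum_i a i) * (\sum_j b j))
      + 8%:R * ((\sum_i f i * a i) * (\sum_j b j))
      + 8%:R * ((\sum_i a i) * (\sum_j g j * b j)).
  rewrite !big_distrlr/= !mulr_sumr -!big_split/=; apply: eq_bigr => i _.
  rewrite !mulr_sumr -!big_split/=; apply: eq_bigr => j _.
  by ring.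
by rewrite a1 b1; lra.
Qed.

Lemma trivial_for_product (R : realType) b U (mu nu : probability cantor R) :
  optimal_in (prefix_free_in_class b) U -> length_normalized R U ->
  trivial_for U mu -> trivial_for U nu ->
  trivial_for U (product_probability mu nu).
Proof.
move=> optU norm [s mus] [t nut]; have [k kU] := shortest_exists optU.
have normk x : (k (zeros (size x)) <= k x)%N.
  by have := norm x; rewrite !(complexity_shortest R _ kU) lee_fin ler_nat.
have [c joinc] := shortest_join optU kU normk.
exists (c + 8 * s + 8 * t)%N => n.
rewrite (mean_complexity_shortest _ _ kU) (complexity_shortest R _ kU) -EFinD lee_fin.
(* The sum now runs over pairs of halves, where the product measure of a cylinder factorizes. *)
rewrite (reindex _ (onW_bij _ (join_tuple_bij n))).
have := mus (uphalf n); have := nut n./2.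
rewrite !(mean_complexity_shortest _ _ kU) !(complexity_shortest R _ kU) -!EFinD !lee_fin.
move=> nu_le mu_le.
have := weighted_excess ((k (zeros n))%:R + c%:R)
  (sum_fine_cylinder mu (uphalf n)) (sum_fine_cylinder nu n./2) mu_le nu_le.
rewrite pair_bigA/= => le.
apply: le_trans (le_trans le _); last by rewrite 2!natrD !natrM; lra.
apply: ler_sum => -[x y] _.
have := product_probability_cylinder mu nu (x, y) => /= ->.
rewrite fineM; try exact: fin_num_measure (measurable_cylinder _).
apply: ler_wpM2r; first by rewrite mulr_ge0// fine_ge0.
have := joinc n x y (size_tuple x) (size_tuple y).
(* Length normalization makes the differences in [nat] exact, so they cast to the real differences
   being averaged. *)
rewrite -(ler_nat R) 3!natrD !natrM !natrB; last 2 first.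
- by have := normk y; rewrite size_tuple.
- by have := normk x; rewrite size_tuple.
by move=> /le_trans; apply; lra.
Qed.

Theorem theorem5p7 (R : realType) (UC UK : machine)
    (universal_UC : universal UC)
    (universal_UK : prefix_free_universal UK)
    (normalized_UC : length_normalized R UC)
    (normalized_UK : length_normalized R UK)
    (mu nu : probability cantor R) :
  (trivial_for UK mu -> trivial_for UK nu ->
    trivial_for UK (product_probability mu nu)) /\
  (trivial_for UC mu -> trivial_for UC nu ->
    trivial_for UC (product_probability mu nu)).
Proof.
split.
- apply: (@trivial_for_product _ true) => //; case: universal_UK => pf opt.
  split; first exact/prefix_free_in_classT.
  by move=> M /prefix_free_in_classT; exact: opt.
(* Every machine is prefix-free within each program size, so plain universality is optimality in the
   class for [false]. *)
- apply: (@trivial_for_product _ false) => //; case: universal_UC => _ opt.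
  by split=> [|M _]; [exact: prefix_free_in_classF | exact: opt].
Qed.
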